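(* Let $(B\subset C,D\subset A)$ be a quadruple of simple unital $C^*$-algebras (i.e. $C$ and $D$ are intermediate to the unital inclusion $B\subset A$) with a conditional expectation from $A$ onto $B$ of index-finite type. Let $\Theta=e_Ce_D\in B'\cap A_1$ be the angle operator, $\mathcal{F}:B'\cap A_1\to A'\cap A_2$ the Fourier transform, and $H$ the von Neumann entropy. If the quadruple is a co-commuting square, then $$H\big(|\mathcal{F}(\Theta)|^2\big)=\frac{2}{\sqrt{[A:B]_0}}\;\eta\left(\frac{\sqrt{[A:B]_0}}{[A:C]_0[A:D]_0}\right).$$
   Context: All inclusions are unital (common identity). A conditional expectation $E:A\to B$ is of index-finite type if there is a finite quasi-basis $\{\lambda_1,\dots,\lambda_n\}\subset A$, i.e. $x=\sum_i\lambda_iE(\lambda_i^*x)$ for all $x\in A$; then $\mathrm{Ind}_w(E)=\sum_i\lambda_i\lambda_i^*$ (Watatani index, a scalar when $A$ is simple). For simple unital $B\subset A$ with an expectation of index-finite type there is a unique minimal conditional expectation $E^A_B$ (the one of smallest index), and $[A:B]_0:=\mathrm{Ind}_w(E^A_B)=:\delta^2$. Tower: $A_1$ is the $C^*$-basic construction of $B\subset A$ with respect to $E^A_B$, i.e. the algebra of adjointable right $B$-linear maps of the Hilbert $B$-module $A$ (inner product $E^A_B(x^*y)$), generated by $A$ (left multiplication) and the Jones projection $e_1:a\mapsto E^A_B(a)$. Put $A_{-1}=B$, $A_0=A$; iterating gives $B\subset A\subset A_1\subset A_2\subset\cdots$ of simple unital $C^*$-algebras, with minimal conditional expectations $E^{A_k}_{A_{k-1}}$,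 and $e_{k+1}\in A_{k+1}$ is the Jones projection of $A_{k-1}\subset A_k$. The relative commutants $B'\cap A_k$ are finite-dimensional, and $\mathrm{tr}:=E^A_B\circ E^{A_1}_A\circ\cdots\circ E^{A_k}_{A_{k-1}}$ restricted to $B'\cap A_k$ is a faithful tracial state (compatible for different $k$). Intermediate algebras: for an intermediate simple unital $C^*$-subalgebra $B\subset C\subset A$ there are minimal conditional expectations $E^A_C$ and $E^C_B=E^A_B|_C$ with $E^A_B=E^C_B\circ E^A_C$; $[A:C]_0$ and $[C:B]_0$ are the corresponding minimal indices. The Jones projection $e_C$ of $E^A_C$ is the map $a\mapsto E^A_C(a)$, viewed as an element of $B'\cap A_1$. The $C^*$-basic construction $C_1$ of $C\subset A$ is the subalgebra of $A_1$ generated by $A$ and $e_C$; it is simple and $A\subset C_1\subset A_1$. Similarly for $D$. Commuting squares: $(B\subset C,D\subset A)$ is a commuting square if $E^A_CE^A_D=E^A_DE^A_C=E^A_B$; it is co-commuting if the dual quadruple $(A\subset C_1,D_1\subset A_1)$ is a commuting square, i.e. $E^{A_1}_{C_1}E^{A_1}_{D_1}=E^{A_1}_{D_1}E^{A_1}_{C_1}=E^{A_1}_A$. Fourier transform: $\mathcal{F}(x)=\delta^3E^{B'\cap A_2}_{A'\cap A_2}(xe_2e_1)$ for $x\in B'\cap A_1$, where $E^{B'\cap A_2}_{A'\cap A_2}(y)=\frac{1}{[A:B]_0}\sum_i\lambda_iy\lambda_i^*$ is the trace-preserving conditional expectation, $\{\lambda_i\}$ being a quasi-basis of $E^A_B$.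 Entropy: $\eta(t)=-t\log t$ for $t>0$, $\eta(0)=0$. For $x$ in $B'\cap A_1$ or in $A'\cap A_2$, $|x|^2=x^*x$ and $H(|x|^2)=\mathrm{tr}(\eta(|x|^2))$ (functional calculus). *)

(* Defs.v *)
From HB Require Import structures.
From mathcomp Require Import all_boot all_order all_algebra.
From mathcomp Require Import complex.
From mathcomp Require Import boolp classical_sets reals topology normedtype exp.

Set Implicit Arguments.
Unset Strict Implicit.
Unset Printing Implicit Defensive.
Import Order.TTheory GRing.Theory Num.Theory.
Import numFieldNormedType.Exports.

Local Open Scope classical_set_scope.
Local Open Scope complex_scope.
Local Open Scope ring_scope.

(** * Unital C*-algebras *)

(* The norm is a separate real-valued function: the normed modules over [R[i]]
   cannot be joined with the ring structures in the hierarchy.  [GRing.Algebra]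
   includes [1 != 0], so the zero algebra is excluded. *)
HB.mixin Record isCStarAlgebra (R : realType) (A : Type)
    of GRing.Algebra R[i] A := {
  star : A -> A;
  cnorm : A -> R;
  starK : involutive star;
  starD : forall x y : A, star (x + y) = star x + star y;
  starZ : forall (c : R[i]) (x : A), star (c *: x) = c^* *: star x;
  starM : forall x y : A, star (x * y) = star y * star x;
  cnorm_eq0 : forall x : A, cnorm x = 0 -> x = 0;
  cnormD : forall x y : A, cnorm (x + y) <= cnorm x + cnorm y;
  cnormZ : forall (c : R[i]) (x : A), cnorm (c *: x) = Normc.normc c * cnorm x;
  cnormM : forall x y : A, cnorm (x * y) <= cnorm x * cnorm y;
  cnorm_complete : forall u : nat -> A,
    (forall e : R, 0 < e ->
       exists n0 : nat, forall m n : nat, (n0 <= m)%N -> (n0 <= n)%N ->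
         cnorm (u m - u n) < e) ->
    exists l : A, (cnorm (u n - l) @[n --> \oo] --> (0 : R));
  cstar_identity : forall x : A, cnorm (star x * x) = cnorm x ^+ 2
}.

#[short(type="cstarAlgType")]
HB.structure Definition CStarAlgebra (R : realType) :=
  {A of isCStarAlgebra R A & GRing.Algebra R[i] A}.

Section CStarSubalgebras.
Context {R : realType} {A : cstarAlgType R}.
Implicit Types (N I S : set A).

Definition norm_closed (S : set A) : Prop :=
  forall (u : nat -> A) (l : A), (forall n, S (u n)) ->
    (cnorm (u n - l) @[n --> \oo] --> (0 : R)) -> S l.

Definition cstar_subalgebra (N : set A) : Prop :=
  [/\ N 1,
      forall (c : R[i]) x y, N x -> N y -> N (c *: x + y),
      forall x y, N x -> N y -> N (x * y),
      forall x, N x -> N (star x) &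
      norm_closed N].

Definition cstar_generated (S : set A) : set A :=
  [set x | forall N, cstar_subalgebra N -> S `<=` N -> N x].

Definition closed_ideal (N I : set A) : Prop :=
  [/\ I `<=` N, I 0,
      forall x y, I x -> I y -> I (x + y),
      forall a x, N a -> I x -> I (a * x) /\ I (x * a) &
      norm_closed I].

Definition simple_cstar_subalgebra (N : set A) : Prop :=
  cstar_subalgebra N /\
  forall I, closed_ideal N I -> I = [set 0] \/ I = N.

End CStarSubalgebras.

(** * Conditional expectations and the Watatani index *)

Section ConditionalExpectations.
Context {R : realType} {A : cstarAlgType R}.
Implicit Types (N : set A) (E : A -> A) (s : seq A).

Definition positive (x : A) : Prop := exists y, x = star y * y.

(* A conditional expectation of [A] onto [N], as a map of [A] into itself. *)
Definition conditional_expectation N E : Prop :=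
  [/\ forall (c : R[i]) x y, E (c *: x + y) = c *: E x + E y,
      forall x, N (E x),
      forall b, N b -> E b = b,
      forall b x b', N b -> N b' -> E (b * x * b') = b * E x * b' &
      forall x, positive x -> positive (E x)].

Definition quasi_basis E s : Prop :=
  forall x, x = \sum_(l <- s) l * E (star l * x).

(* [E] is of index-finite type, with Watatani index [w]. *)
Definition has_index E (w : A) : Prop :=
  exists2 s : seq A, quasi_basis E s & w = \sum_(l <- s) l * star l.

(* Indices are compared for the order of the C*-algebra, which is the usual
   order of the reals when they are scalars. *)
Definition minimal_expectation N E : Prop :=
  conditional_expectation N E /\
  exists2 w : A, has_index E w &
    forall (E' : A -> A) (w' : A),
      conditional_expectation N E' -> has_index E' w' -> positive (w' - w).

Definition commuting_square (EN EC ED : A -> A) : Prop :=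
  (forall x, EC (ED x) = EN x) /\ (forall x, ED (EC x) = EN x).

End ConditionalExpectations.

(** * The C*-basic construction *)

Section BasicConstruction.
Context {R : realType} {A : cstarAlgType R}.
Implicit Types (B : set A) (E T S : A -> A).

Definition right_module_map B T : Prop :=
  (forall x y, T (x + y) = T x + T y) /\
  (forall x b, B b -> T (x * b) = T x * b).

(* [S] is an adjoint of [T] for the inner product [(x, y) |-> E (x^* y)]. *)
Definition adjoint_pair E T S : Prop :=
  forall x y, E (star (T x) * y) = E (star x * S y).

(* A C*-algebra together with a *-isomorphism [bc_act] onto the algebra of
   adjointable right [B]-linear maps of the Hilbert module [A].  Its norm is
   then the operator norm, since a *-isomorphism of C*-algebras is isometric. *)
Record basic_construction (B : set A) (E : A -> A) := BasicConstruction {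
  bc_alg :> cstarAlgType R;
  bc_act : bc_alg -> A -> A;
  bc_actP : forall (c : R[i]) x y a,
    bc_act (c *: x + y) a = c *: bc_act x a + bc_act y a;
  bc_act1 : forall a, bc_act 1 a = a;
  bc_actM : forall x y a, bc_act (x * y) a = bc_act x (bc_act y a);
  bc_act_star : forall x, adjoint_pair E (bc_act x) (bc_act (star x));
  bc_act_module : forall x, right_module_map B (bc_act x);
  bc_act_inj : injective bc_act;
  bc_act_surj : forall T S,
    right_module_map B T -> right_module_map B S -> adjoint_pair E T S ->
    exists x, bc_act x = T;
  bc_incl : A -> bc_alg;
  bc_inclP : forall a x, bc_act (bc_incl a) x = a * x;
  bc_jones : bc_alg;
  bc_jonesP : forall x, bc_act bc_jones x = E x
}.

End BasicConstruction.

Arguments bc_act {R A B E} b x a.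
Arguments bc_incl {R A B E} b a.
Arguments bc_jones {R A B E} b.

(** * Functional calculus and entropy *)

Section FunctionalCalculus.
Context {R : realType} {A : cstarAlgType R}.

Definition real_spectrum (a : A) : set R :=
  [set t : R | ~ exists b : A,
     (a - t%:C%:A) * b = 1 /\ b * (a - t%:C%:A) = 1].

Definition poly_eval (p : {poly R}) (a : A) : A :=
  \sum_(i < size p) (p`_i)%:C *: a ^+ i.

(* [y = f(a)] for [a] self-adjoint: the real spectrum is then the spectrum,
   and [f(a)] is the only element approximated by each [p(a)] as well as [p]
   approximates [f] uniformly on the spectrum. *)
Definition is_fun_calc (f : R -> R) (a y : A) : Prop :=
  forall (p : {poly R}) (e : R),
    (forall t, real_spectrum a t -> `|p.[t] - f t| <= e) ->
    cnorm (poly_eval p a - y) <= e.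

Definition fun_calc (f : R -> R) (a : A) : A := xget 0 [set y | is_fun_calc f a y].

(* The [c] such that [a] is the scalar [c] of [A]. *)
Definition scalar_value (a : A) : R[i] := xget 0 [set c | a = c%:A].

End FunctionalCalculus.

Definition eta {R : realType} (t : R) : R := if 0 < t then - (t * ln t) else 0.

(* [tau] is the composite of the expectations of [M] down to [B]; on the
   relative commutant of [B] its values are scalars. *)
Definition trace {R : realType} {M A : cstarAlgType R} (tau : M -> A) (x : M)
  : R[i] := scalar_value (tau x).

Definition entropy {R : realType} {M A : cstarAlgType R} (tau : M -> A) (x : M)
  : R[i] := trace tau (fun_calc eta (star x * x)).

(** * The tower *)

Section Tower.
Context {R : realType} {A : cstarAlgType R} {B : set A} {EB : A -> A}.
Variables (A1 : basic_construction B EB) (E1 : A1 -> A).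
Variable (A2 : basic_construction (range (bc_incl A1)) (bc_incl A1 \o E1)).

(* [d] is the index of [B] in [A], and [s] a quasi-basis of [EB]. *)
Definition fourier (d : R) (s : seq A) (x : A1) : A2 :=
  let i2 := bc_incl A2 in
  ((Num.sqrt d) ^+ 3)%:C *: (d^-1%:C *:
    \sum_(l <- s) i2 (bc_incl A1 l) *
      (i2 x * bc_jones A2 * i2 (bc_jones A1)) * i2 (bc_incl A1 (star l))).

Definition intermediate_basic_construction (eC : A1) : set A1 :=
  cstar_generated (range (bc_incl A1) `|` [set eC]).

End Tower.

(* Main.v *)
(* The minimality of an expectation [E] onto [N] is used through its first
   variation.  Comparing its index with that of [x |-> E (h x h)], for [h] close
   to [1] in the commutant of [N], shows that on this commutant [sum_l l x l^*]
   is the index times [E x], and that [E] is a trace there.  Hence the minimal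
   expectation of a basic construction sends the Jones projection to the inverse
   of the index (and has the same index), and the minimal expectation onto [B]
   factors through the one onto [C].

   Let [delta^2 = [A:B]].  As an operator on [A_1], the Fourier transform of [x]
   maps [a e_1 b] to [a x b / delta], and that of [Theta = e_C e_D] is
   self-adjoint.  Since the elements of [C_1] commute with the operator
   [a e_1 b |-> a e_C b] on [A_1], the expectation [E_{C_1}] maps [e_1] to
   [([A:C]/[A:B]) e_C], so that a co-commuting square satisfies
   [sum_l E_D(l) e_C E_D(l)^* = [A:B]/([A:C][A:D])].  This sum appears in the
   square of [F(Theta)], which is therefore [t = delta/([A:C][A:D])] times a
   projection, of trace [1/(delta t)]. *)
Require Import Defs.
From Stdlib Require Ncring Ncring_tac.
From mathcomp Require Import all_boot all_order all_algebra.
From mathcomp Require Import complex.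
From mathcomp Require Import boolp classical_sets reals topology normedtype exp.
From mathcomp Require Import ring lra.
Import Order.TTheory GRing.Theory Num.Theory.
Import numFieldNormedType.Exports.
Set Implicit Arguments.
Unset Strict Implicit.
Unset Printing Implicit Defensive.
Local Open Scope classical_set_scope.
Local Open Scope complex_scope.
Local Open Scope ring_scope.

(** A minimal expectation is known here only by its extremal property. Traciality, the value [E1 e1]
    and the compatibility of [EB] with [EC] all have to be extracted from it; even [star eC = eC] is
    equivalent to [EB \o EC = EB]. This is why most of the work precedes the square itself.

    The test elements are h = 1 + z with E z = 0: then E(h^2) = 1 + E(z^2) has no linear term, so
    the index changes to first order by -2 sum_l l z l^*, and since z may be replaced by -z this sum
    must vanish. Traciality makes right multiplication by an element of the commutant of N
    adjointable, which identifies this commutant with the commutant of A in the basic construction;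
    evaluating sum_k k x k^* on such x in two ways shows that (E1 e)^2 is a scalar.

    Positivity means being of the form y^* y, and no spectral theory is assumed: a norm-convergent
    square root and unitaries a + i sqrt(1 - a^2) take its place. Simplicity enters only through the
    triviality of centres. *)

Section NcRing.
Context {A : nzRingType}.
#[export] Instance nzRing_ring_ops : @Ncring.Ring_ops A 0 1 +%R *%R (fun x y => x - y) -%R eq := {}.
#[export] Instance nzRing_ring :
  @Ncring.Ring A 0 1 +%R *%R (fun x y => x - y) -%R eq nzRing_ring_ops.
Proof.
split.
- by split; [|move=> x y ->|move=> x y z -> ->].
- by move=> x y -> u v ->.
- by move=> x y -> u v ->.
- by move=> x y -> u v ->.
- by move=> x y ->.
- exact (@add0r A).
- exact (@addrC A).
- exact (@addrA A).
- exact (@mul1r A).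
- exact (@mulr1 A).
- exact (@mulrA A).
- exact (@mulrDl A).
- exact (fun x y z => mulrDr z x y).
- by [].
- exact (@subrr A).
Qed.
End NcRing.
Ltac ncring :=
  repeat match goal with x := _ |- _ => clearbody x end;
  Ncring_tac.non_commutative_ring.

(** * Elementary identities for the involution and the norm *)

Section CStarBasics.
Context {R : realType} {A : cstarAlgType R}.
Implicit Types (x y z : A) (r : R).

Lemma star0 : star 0 = 0 :> A.
Proof. by apply: (@addrI _ (star 0)); rewrite -starD !addr0. Qed.

Lemma starN x : star (- x) = - star x.
Proof. by apply/eqP; rewrite -addr_eq0 -starD addNr star0. Qed.

Lemma starB x y : star (x - y) = star x - star y.
Proof. by rewrite starD starN. Qed.

Lemma star1 : star 1 = 1 :> A.
Proof. by have := starM (star 1) (1 : A); rewrite mulr1 starK mulr1. Qed.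

Lemma starZr r x : star (r%:C *: x) = r%:C *: star x.
Proof. by rewrite starZ conj_Creal//; apply/complex_realP; exists r. Qed.

Lemma star_sum (I : Type) (s : seq I) (F : I -> A) :
  star (\sum_(i <- s) F i) = \sum_(i <- s) star (F i).
Proof. by elim/big_rec2: _ => [|i y1 y2 _ <-]; rewrite ?star0 ?starD. Qed.

Lemma normc_real r : Normc.normc (r%:C : R[i]) = `|r|.
Proof. by rewrite /Normc.normc /= expr0n addr0 sqrtr_sqr. Qed.

Lemma cnormZr r x : cnorm (r%:C *: x) = `|r| * cnorm x.
Proof. by rewrite cnormZ normc_real. Qed.

Lemma cnorm0 : cnorm (0 : A) = 0.
Proof. by have := cnormZr 0 0; rewrite scaler0 normr0 mul0r. Qed.

Lemma cnormN x : cnorm (- x) = cnorm x.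
Proof.
by rewrite -scaleN1r; have := cnormZr (-1) x; rewrite normrN1 mul1r rmorphN1.
Qed.

Lemma cnorm_ge0 x : 0 <= cnorm x.
Proof. by have := cnormD x (- x); rewrite subrr cnorm0 cnormN; lra. Qed.

Lemma cnormB x y : cnorm (x - y) <= cnorm x + cnorm y.
Proof. by rewrite -(cnormN y); exact: cnormD. Qed.

Lemma cnorm_distC x y : cnorm (x - y) = cnorm (y - x).
Proof. by rewrite -cnormN opprB. Qed.

Lemma cnorm_neq0 x : x != 0 -> 0 < cnorm x.
Proof.
move=> x0; rewrite lt_neqAle cnorm_ge0 andbT eq_sym; apply: contra x0 => /eqP.
by move=> /cnorm_eq0 ->.
Qed.

Lemma cstar_eq0 x : star x * x = 0 -> x = 0.
Proof.
move=> h; apply: cnorm_eq0; have := cstar_identity x.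
by rewrite h cnorm0 => /esym/eqP; rewrite expf_eq0 => /eqP.
Qed.

Lemma cnorm_star_le x : cnorm x <= cnorm (star x).
Proof.
have [->|x0] := eqVneq x 0; first by rewrite star0.
have x1 := cnorm_neq0 x0.
rewrite -(ler_pM2r x1) -expr2 -cstar_identity; exact: cnormM.
Qed.

Lemma cnorm_star x : cnorm (star x) = cnorm x.
Proof.
by apply/eqP; rewrite eq_le cnorm_star_le andbT -{2}(starK x) cnorm_star_le.
Qed.

Lemma cnorm1 : cnorm (1 : A) = 1.
Proof.
have := cstar_identity (1 : A); rewrite star1 mulr1 => h.
have n1 : 0 < cnorm (1 : A) by apply: cnorm_neq0; exact: oner_neq0.
by apply: (mulfI (lt0r_neq0 n1)); rewrite -expr2 -h mulr1.
Qed.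

Lemma scaleCKV r x : r != 0 -> r%:C *: (r^-1%:C *: x) = x.
Proof. by move=> r0; rewrite scalerA -rmorphM /= divff// rmorph1 scale1r. Qed.

Lemma scaleCVK r x : r != 0 -> r^-1%:C *: (r%:C *: x) = x.
Proof. by move=> r0; rewrite scalerA -rmorphM /= mulVf// rmorph1 scale1r. Qed.

Lemma cnorm_scalar r : cnorm (r%:C%:A : A) = `|r|.
Proof. by rewrite cnormZr cnorm1 mulr1. Qed.

Lemma cnorm_sqr_selfadjoint x : star x = x -> cnorm (x * x) = cnorm x ^+ 2.
Proof. by move=> sx; rewrite -cstar_identity sx. Qed.

Lemma cnorm_sum (I : Type) (s : seq I) (F : I -> A) :
  cnorm (\sum_(i <- s) F i) <= \sum_(i <- s) cnorm (F i).
Proof.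
elim/big_rec2: _ => [|i y1 y2 _ h]; first by rewrite cnorm0.
by apply: le_trans (cnormD _ _) _; rewrite lerD2l.
Qed.

Lemma cnorm_small_eq0 x : (forall e, 0 < e -> cnorm x <= e) -> x = 0.
Proof.
move=> h; apply: cnorm_eq0; apply/eqP; rewrite eq_le cnorm_ge0 andbT.
by apply/ler_addgt0Pr => e e0; rewrite add0r h.
Qed.

Lemma scalar_inj (c c' : R[i]) : c%:A = c'%:A :> A -> c = c'.
Proof.
move/eqP; rewrite -subr_eq0 -scalerBl => /eqP h; apply/eqP; rewrite -subr_eq0.
apply/negPn/negP => cc; move: (oner_neq0 A); rewrite -(scalerK cc 1) h scaler0.
by rewrite eqxx.
Qed.

Lemma star_scalar (c : R[i]) : star (c%:A : A) = (c^*)%:A.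
Proof. by rewrite starZ star1. Qed.

Lemma cvg_cnormP (u : nat -> A) (l : A) :
  (cnorm (u n - l) @[n --> \oo] --> (0 : R)) <->
  (forall e, 0 < e -> exists n0, forall n, (n0 <= n)%N -> cnorm (u n - l) <= e).
Proof.
split.
  move=> /cvgr0Pnorm_le h e e0; have [n0 _ hn] := h _ e0.
  exists n0 => n n0n; have := hn n n0n; rewrite /= ger0_norm ?cnorm_ge0//.
move=> h; apply/cvgr0Pnorm_le => e e0; have [n0 hn] := h _ e0.
by exists n0 => // n /= n0n; rewrite ger0_norm ?cnorm_ge0 ?hn.
Qed.

Lemma cnorm_lim_le (u : nat -> A) (l : A) r :
  (cnorm (u n - l) @[n --> \oo] --> (0 : R)) ->
  (forall n, cnorm (u n) <= r) -> cnorm l <= r.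
Proof.
move=> /cvg_cnormP h ur; apply/ler_addgt0Pr => e e0; have [n0 hn] := h _ e0.
rewrite -[l](subrK (u n0)) addrC; apply: le_trans (cnormD _ _) _.
by rewrite lerD// cnorm_distC hn.
Qed.

End CStarBasics.

(** Self-adjointness, commutation and annihilation are zero sets of Lipschitz maps; this is how each
    of them passes to a norm limit below. *)
Lemma norm_closed_eq (R : realType) (A A' : cstarAlgType R) (F : A -> A') (K : R) :
  (forall x y, cnorm (F x - F y) <= K * cnorm (x - y)) ->
  norm_closed [set x | F x = 0].
Proof.
move=> FK u l u0 /cvg_cnormP h; apply: cnorm_small_eq0 => e e0 /=.
have K0 : 0 < `|K| + 1 by rewrite ltr_wpDl.
have [n0 /(_ _ (leqnn n0)) hn] := h _ (divr_gt0 e0 K0).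
rewrite -[F l]subr0 -(u0 n0); apply: le_trans (FK _ _) _.
rewrite cnorm_distC; move: hn; rewrite ler_pdivlMr// => hn.
apply: le_trans hn; rewrite mulrC ler_wpM2l ?cnorm_ge0//.
by have := ler_norm K; lra.
Qed.

(** * Square roots and inverses *)

Section SquareRoot.
Context {R : realType} {A : cstarAlgType R}.
Implicit Types (x y z w : A) (r : R).

Lemma cnorm_subXX x y r : cnorm x <= r -> cnorm y <= r ->
  cnorm (x * x - y * y) <= (r + r) * cnorm (x - y).
Proof.
move=> xr yr; rewrite (_ : _ - _ = x * (x - y) + (x - y) * y); last by ncring.
have := cnormD (x * (x - y)) ((x - y) * y).
have := cnormM x (x - y); have := cnormM (x - y) y; have := cnorm_ge0 (x - y).
by nra.
Qed.

Lemma dominated_dist (u : nat -> A) (b : nat -> R) m n :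
  (forall n, cnorm (u n.+1 - u n) <= b n.+1 - b n) -> (n <= m)%N ->
  cnorm (u m - u n) <= b m - b n.
Proof.
move=> h /subnK <-; elim: (m - n)%N => [|k IH].
  by rewrite !subrr cnorm0.
have {}h := h (k + n)%N; rewrite addSn.
have := cnormD (u (k + n).+1 - u (k + n)%N) (u (k + n)%N - u n).
by rewrite addrA subrK; lra.
Qed.

(** Majorant method: [b] is nondecreasing and bounded, hence close to its supremum from some rank
    on, and the increments of [u] telescope below those of [b]. No rate of convergence is
    required. *)
Lemma dominated_cvg (u : nat -> A) (b : nat -> R) M :
  (forall n, cnorm (u n.+1 - u n) <= b n.+1 - b n) -> (forall n, b n <= M) ->
  exists l, (cnorm (u n - l) @[n --> \oo] --> (0 : R)).
Proof.
move=> ub bM; apply: cnorm_complete => e e0.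
have sup_b : has_sup (range b).
  by split; [exists (b 0%N), 0%N | exists M => _ [n _ <-]].
have [_ [n0 _ <-] hn0] := sup_adherent e0 sup_b.
have bsup n : b n <= sup (range b) by apply: sup_ubound; [case: sup_b | exists n].
have b_incr : {homo b : m n / (m <= n)%N >-> m <= n}.
  apply: homo_leq => //; first exact: le_trans.
  by move=> n; rewrite -subr_ge0; apply: le_trans (ub n); exact: cnorm_ge0.
exists n0 => m n; wlog nm : m n / (n <= m)%N.
  move=> H; have [|/ltnW] := leqP n m; first exact: H.
  by move=> mn m0 n0'; rewrite cnorm_distC; exact: H.
move=> m0 n0'; apply: le_lt_trans (dominated_dist ub nm) _.
by have := b_incr _ _ n0'; have := bsup m; lra.
Qed.

(** A fixed point of y = (x + y^2)/2 is a y with (1 - y)^2 = 1 - x, so the limit plays the role of 1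
    - sqrt(1 - x). *)
Fixpoint sqrt_iter x n : A :=
  if n is n'.+1 then 2^-1%:C *: (x + sqrt_iter x n' * sqrt_iter x n') else 0.

(** The same iteration run at the scalar x = 1. It is the majorant for every x of norm at most 1; a
    contraction argument would fail at norm exactly 1. *)
Fixpoint sqrt_bound n : R :=
  if n is n'.+1 then 2^-1 * (1 + sqrt_bound n' * sqrt_bound n') else 0.

Lemma sqrt_iterS x n :
  sqrt_iter x n.+1 = 2^-1%:C *: (x + sqrt_iter x n * sqrt_iter x n).
Proof. by []. Qed.

Lemma sqrt_bound_itv n : 0 <= sqrt_bound n <= 1.
Proof. by elim: n => [|n /andP[h0 h1]] /=; rewrite ?lexx ?ler01//; nra. Qed.

Lemma sqrt_iter_bound x n : cnorm x <= 1 -> cnorm (sqrt_iter x n) <= sqrt_bound n.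
Proof.
move=> x1; elim: n => [|n IH] /=; first by rewrite cnorm0.
rewrite cnormZr ger0_norm ?invr_ge0// ler_wpM2l ?invr_ge0//.
apply: le_trans (cnormD _ _) _; rewrite lerD//.
by apply: le_trans (cnormM _ _) _; rewrite ler_pM ?cnorm_ge0.
Qed.

Lemma sqrt_iter_step x n : cnorm x <= 1 ->
  cnorm (sqrt_iter x n.+1 - sqrt_iter x n) <= sqrt_bound n.+1 - sqrt_bound n.
Proof.
move=> x1; elim: n => [|n IH].
  by rewrite /= !mulr0 !addr0 !subr0 mulr1 cnormZr ger0_norm ?invr_ge0//;
    rewrite ler_piMr ?invr_ge0.
rewrite [in X in X <= _](sqrt_iterS x n.+1) [X in _ - X]sqrt_iterS -scalerBr.
rewrite opprD addrACA subrr add0r cnormZr ger0_norm ?invr_ge0//.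
set b := sqrt_bound n.+1 in IH *; set c := sqrt_bound n in IH *.
have -> : sqrt_bound n.+2 - sqrt_bound n.+1 = 2^-1 * ((b + c) * (b - c)).
  rewrite -[LHS]/(2^-1 * (1 + b * b) - 2^-1 * (1 + c * c)); move: (b) (c) => b' c'.
  by ring.
rewrite ler_wpM2l ?invr_ge0//.
set u := sqrt_iter x n.+1 in IH *; set v := sqrt_iter x n in IH *.
have ub : cnorm u <= b := sqrt_iter_bound _ x1.
have vc : cnorm v <= c := sqrt_iter_bound _ x1.
rewrite (_ : _ - _ = u * (u - v) + (u - v) * v); last by ncring.
have := cnormD (u * (u - v)) ((u - v) * v).
have := cnormM u (u - v); have := cnormM (u - v) v.
have := ler_pM (cnorm_ge0 u) (cnorm_ge0 (u - v)) ub IH.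
have := ler_pM (cnorm_ge0 (u - v)) (cnorm_ge0 v) IH vc.
by lra.
Qed.

(** The iterates are polynomials in x, whence the last two clauses: they let the root of a central
    element of a subalgebra stay central and inside it. *)
Lemma sqrt_exists x : star x = x -> cnorm x <= 1 ->
  exists y, [/\ star y = y, cnorm y <= 1, (1 - y) * (1 - y) = 1 - x,
    forall w, w * x = x * w -> w * y = y * w &
    forall N, cstar_subalgebra N -> N x -> N y].
Proof.
move=> sx x1; have [y hy] : exists y, (cnorm (sqrt_iter x n - y) @[n --> \oo] --> (0 : R)).
  apply: (dominated_cvg (b := sqrt_bound) (M := 1)) => n.
    exact: sqrt_iter_step.
  by have /andP[] := sqrt_bound_itv n.
have yn1 n : cnorm (sqrt_iter x n) <= 1.
  apply: le_trans (sqrt_iter_bound n x1) _.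
  by have /andP[] := sqrt_bound_itv n.
have y1 : cnorm y <= 1 := cnorm_lim_le hy yn1.
exists y; split=> //.
- apply/eqP; rewrite -subr_eq0; apply/eqP.
  apply: (norm_closed_eq (F := fun z => star z - z) (K := 2)) hy => /= [u v|n].
    have := cnormB (star (u - v)) (u - v); rewrite cnorm_star starB.
    rewrite [X in cnorm X](_ : _ = star u - u - (star v - v)); last by ncring.
    by lra.
  apply/eqP; rewrite subr_eq0; apply/eqP.
  by elim: n => [|n IH] /=; rewrite ?star0// starZr starD starM IH sx.
- have -> : (1 - y) * (1 - y) = 1 - (2%:C *: y - y * y).
    rewrite (_ : 2%:C = 1 + 1); last by rewrite (natrD _ 1 1) rmorphD.
    by rewrite scalerDl !scale1r; ncring.
  congr (1 - _); apply/eqP; rewrite -subr_eq0; apply/eqP.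
  apply: cnorm_small_eq0 => e e0; have e4 : 0 < e / 4 by rewrite divr_gt0.
  have /cvg_cnormP /(_ _ e4) [n0 hn] := hy.
  have h0 := hn _ (leqnn _); have h1 := hn _ (leqnSn _).
  set u := sqrt_iter x n0 in h0 h1; set v := sqrt_iter x n0.+1 in h1.
  have vE : 2%:C *: v = x + u * u.
    by rewrite /v sqrt_iterS scaleCKV ?pnatr_eq0.
  have -> : 2%:C *: y - y * y - x = 2%:C *: (y - v) + (u * u - y * y).
    by rewrite scalerBr vE; ncring.
  have := cnormD (2%:C *: (y - v)) (u * u - y * y); rewrite cnormZr cnorm_distC.
  have := cnorm_subXX (yn1 n0) y1; rewrite -/u ger0_norm//.
  by lra.
- move=> w wx; apply/eqP; rewrite -subr_eq0; apply/eqP.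
  apply: (norm_closed_eq (F := fun z => w * z - z * w)
    (K := cnorm w + cnorm w)) hy => /= [u v|n].
    rewrite (_ : _ - _ = w * (u - v) - (u - v) * w); last by ncring.
    by have := cnormB (w * (u - v)) ((u - v) * w); have := cnormM w (u - v);
      have := cnormM (u - v) w; lra.
  apply/eqP; rewrite subr_eq0; apply/eqP; elim: n => [|n IH] /=.
    by rewrite mulr0 mul0r.
  by rewrite -scalerAr -scalerAl mulrDr mulrDl wx mulrA IH -mulrA IH mulrA.
- move=> N [N1 NL NM _ Nc] Nx; apply: Nc hy => n.
  have N0 : N 0 by have := NL (-1) 1 1 N1 N1; rewrite scaleN1r addNr.
  elim: n => //= n IH; rewrite -[_ *: _]addr0; apply: (NL) => //.
  by rewrite -[X in X + _]scale1r; apply: (NL) => //; exact: NM.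
Qed.

Fixpoint geometric_iter x n : A :=
  if n is n'.+1 then 1 + x * geometric_iter x n' else 0.

Fixpoint geometric_bound n : R :=
  if n is n'.+1 then 1 + 2^-1 * geometric_bound n' else 0.

Lemma neumann_inverse x : cnorm x <= 2^-1 ->
  exists g, [/\ (1 - x) * g = 1, g * (1 - x) = 1 & cnorm g <= 2].
Proof.
move=> x1; have [g hg] : exists g,
    (cnorm (geometric_iter x n - g) @[n --> \oo] --> (0 : R)).
  apply: (dominated_cvg (b := geometric_bound) (M := 2)) => n.
    elim: n => [|n IH]; first by rewrite /= !mulr0 !addr0 !subr0 cnorm1.
    rewrite -[geometric_iter x n.+2]/(1 + x * geometric_iter x n.+1).
    rewrite -[X in _ - X]/(1 + x * geometric_iter x n).
    rewrite -[geometric_bound n.+2]/(1 + 2^-1 * geometric_bound n.+1).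
    rewrite -[X in _ <= _ - X]/(1 + 2^-1 * geometric_bound n).
    rewrite opprD addrACA subrr add0r -mulrBr.
    rewrite opprD [leRHS]addrACA subrr add0r -mulrBr.
    by apply: le_trans (cnormM _ _) _; rewrite ler_pM ?cnorm_ge0.
  by elim: n => [|n] /=; lra.
have gE : g = 1 + x * g.
  apply/eqP; rewrite -subr_eq0; apply/eqP; apply: cnorm_small_eq0 => e e0.
  have /cvg_cnormP /(_ (e / 2)) [|n0 hn] := hg; first by rewrite divr_gt0.
  have h0 := hn _ (leqnn _); have h1 := hn _ (leqnSn _).
  set u := geometric_iter x n0 in h0 h1.
  rewrite -[geometric_iter x n0.+1]/(1 + x * u) in h1.
  have -> : g - (1 + x * g) = - (1 + x * u - g) + x * (u - g) by ncring.
  have := cnormD (- (1 + x * u - g)) (x * (u - g)); rewrite cnormN.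
  have := cnormM x (u - g); have := ler_pM (cnorm_ge0 _) (cnorm_ge0 _) x1 h0.
  by lra.
have xg : x * g = g * x.
  apply/eqP; rewrite -subr_eq0; apply/eqP.
  apply: (norm_closed_eq (F := fun z => x * z - z * x)
    (K := cnorm x + cnorm x)) hg => /= [u v|n].
    rewrite (_ : _ - _ = x * (u - v) - (u - v) * x); last by ncring.
    by have := cnormB (x * (u - v)) ((u - v) * x); have := cnormM x (u - v);
      have := cnormM (u - v) x; lra.
  apply/eqP; rewrite subr_eq0; apply/eqP; elim: n => [|n IH] /=.
    by rewrite mulr0 mul0r.
  by rewrite mulrDr mulrDl mulr1 mul1r -mulrA -IH.
have g1 : g - x * g = 1 by rewrite {1}gE addrK.
exists g; split.
- by rewrite mulrBl mul1r.
- by rewrite mulrBr mulr1 -xg.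
have := cnormD 1 (x * g); rewrite -gE cnorm1.
have := cnormM x g; have := ler_wpM2r (cnorm_ge0 g) x1.
by lra.
Qed.

End SquareRoot.

(** * Norm estimates in place of order and spectrum *)

Section Positivity.
Context {R : realType} {A : cstarAlgType R}.
Implicit Types (x y z : A) (r : R).

Lemma cnormMn x n : cnorm (x *+ n) = n%:R * cnorm x.
Proof.
have := cnormZr n%:R x; rewrite rmorph_nat scaler_nat => ->.
by rewrite ger0_norm.
Qed.

Lemma half_double x : 2^-1%:C *: (x *+ 2) = x.
Proof.
have n0 : (2 : R) != 0 by rewrite pnatr_eq0.
by have := scaleCVK x n0; rewrite rmorph_nat scaler_nat.
Qed.

Lemma cnorm_double x : cnorm (x + x) = cnorm x + cnorm x.
Proof. by rewrite -mulr2n cnormMn; ring. Qed.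

Lemma scale_iM x y : ('i *: x) * ('i *: y) = - (x * y).
Proof. by rewrite -scalerAl -scalerAr scalerA -expr2 sqrCi scaleN1r. Qed.

Lemma star_scale_i x : star ('i *: x) = - ('i *: star x).
Proof. by rewrite starZ conjCi scaleNr. Qed.

(* [a + i sqrt(1 - a^2)] is unitary, and its square has real part
   [2 a^2 - 1]. *)
Lemma cnorm_chebyshev2 a : star a = a -> cnorm a <= 1 ->
  cnorm ((1 : A) - (a * a + a * a)) <= 1.
Proof.
move=> sa a1; have aa1 : cnorm (a * a) <= 1.
  by rewrite cnorm_sqr_selfadjoint// expr_le1 ?cnorm_ge0.
have saa : star (a * a) = a * a by rewrite starM sa.
have [y [sy _ yE yc _]] := sqrt_exists saa aa1.
have ya : a * y = y * a by apply: yc; rewrite mulrA.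
pose d : A := 'i *: (1 - y).
have dd : d * d = - (1 - a * a) by rewrite scale_iM yE.
have sd : star d = - d by rewrite star_scale_i starB star1 sy.
have da : d * a = a * d.
  by rewrite -scalerAl -scalerAr mulrBl mulrBr ya mulr1 mul1r.
pose u := a + d; have su : star u = a - d by rewrite starD sa sd.
have uu : star u * u = 1.
  rewrite su /u (_ : _ * _ = a * a + (a * d - d * a) - d * d); last by ncring.
  by rewrite da dd subrr; ncring.
have nu : cnorm u ^+ 2 = 1 by rewrite -cstar_identity uu cnorm1.
have nsu : cnorm (star u) ^+ 2 = 1 by rewrite cnorm_star.
have h : - (u * u + star u * star u) = (1 - (a * a + a * a)) + (1 - (a * a + a * a)).
  rewrite su /u (_ : - _ = - (a * a + a * a) - (d * d + d * d)); last by ncring.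
  by rewrite dd; ncring.
have := cnorm_double ((1 : A) - (a * a + a * a)); rewrite -h cnormN => h2.
have := cnormD (u * u) (star u * star u).
have := cnormM u u; have := cnormM (star u) (star u).
by rewrite -!expr2 nu nsu; lra.
Qed.

(** Twice 1 - a^2 is the sum of 1 and of 1 - 2 a^2, both of norm at most 1. *)
Lemma cnorm_one_sub_sqr a : star a = a -> cnorm a <= 1 -> cnorm ((1 : A) - a * a) <= 1.
Proof.
move=> sa a1; have h := cnorm_chebyshev2 sa a1.
have := cnorm_double ((1 : A) - a * a).
rewrite (_ : _ + _ = 1 + (1 - (a * a + a * a))); last by ncring.
by have := cnormD (1 : A) (1 - (a * a + a * a)); rewrite cnorm1; lra.
Qed.

(* Otherwise [u^* u = -1] after rescaling, and the real and imaginary parts of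
   [u] give [norm (3 - u u^* ) <= 2], whereas [(3 - u u^* ) u = 4 u]. *)
Lemma scalar_positive (c : R[i]) : positive (c%:A : A) -> 0 <= c.
Proof.
move=> [y yE].
have cc : c^* = c.
  by apply: (@scalar_inj R A); rewrite -star_scalar yE starM starK.
have /complex_realP [r rE] : c \is Num.real by rewrite CrealE cc.
move: yE; rewrite {}rE ler0c {cc} => yE; rewrite leNgt; apply/negP => r0.
pose t := (Num.sqrt (- r))^-1; pose u : A := t%:C *: y.
have tt : t * t * r = -1.
  rewrite /t -invfM -expr2 sqr_sqrtr ?oppr_ge0 ?ltW//.
  by rewrite -[X in _ * X]opprK mulrN mulVf// oppr_eq0 lt_eqF.
have uu : star u * u = -1.
  by rewrite starZr -scalerAr -scalerAl -yE !scalerA -!rmorphM tt rmorphN1 scaleN1r.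
have nu : cnorm u ^+ 2 = 1 by rewrite -cstar_identity uu cnormN cnorm1.
have {}nu : cnorm u = 1.
  by apply/eqP; rewrite -sqrp_eq1 ?cnorm_ge0// nu.
pose h : A := 2^-1%:C *: (u + star u); pose k : A := 2^-1%:C *: ('i *: (star u - u)).
have sh : star h = h by rewrite starZr starD starK addrC.
have sk : star k = k by rewrite starZr star_scale_i starB starK -scalerN opprB.
have n2 x : cnorm x <= 2 -> cnorm (2^-1%:C *: x) <= 1.
  by rewrite cnormZr ger0_norm ?invr_ge0// mulrC ler_pdivrMr// mul1r.
have hn : cnorm h <= 1.
  by apply: n2; have := cnormD u (star u); rewrite cnorm_star nu; lra.
have kn : cnorm k <= 1.
  apply: n2; rewrite cnormZ; have := cnormB (star u) u; rewrite cnorm_star nu.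
  have -> : Normc.normc ('i : R[i]) = 1.
    by apply: complexI; have := @normCi R[i]; rewrite normc_def => ->.
  by rewrite mul1r; lra.
(* With u = h - i k or its adjoint, 2 h^2 + 2 k^2 = u u^* + u^* u, and the second term is -1. *)
have hkE : (h * h + h * h) + (k * k + k * k) = u * star u - 1.
  have q4 x : 2^-1%:C *: x * (2^-1%:C *: x) + 2^-1%:C *: x * (2^-1%:C *: x) =
      2^-1%:C *: (x * x).
    rewrite -scalerAl -scalerAr -scalerDl scalerA -rmorphD -rmorphM.
    by congr ((real_complex _ _) *: _); field.
  rewrite /h /k !q4 scale_iM -scalerDr -uu.
  have -> : (u + star u) * (u + star u) - (star u - u) * (star u - u) =
      (u * star u + star u * u) + (u * star u + star u * u) by ncring.
  by rewrite -mulr2n half_double.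
have h3 : cnorm ((1 : A) + 1 + 1 - u * star u) <= 2.
  rewrite (_ : 1 + 1 + 1 - _ = (1 - (h * h + h * h)) + (1 - (k * k + k * k))); last first.
    have -> : (1 - (h * h + h * h)) + (1 - (k * k + k * k)) =
        1 + 1 - ((h * h + h * h) + (k * k + k * k)) by ncring.
    by rewrite hkE; ncring.
  have := cnormD ((1 : A) - (h * h + h * h)) (1 - (k * k + k * k)).
  have := cnorm_chebyshev2 sh hn; have := cnorm_chebyshev2 sk kn; lra.
have := cnormM ((1 : A) + 1 + 1 - u * star u) u.
rewrite (_ : _ * u = u *+ 4) ?cnormMn ?nu; last first.
  rewrite (_ : _ * _ = u + u + u - u * (star u * u)); last by ncring.
  by rewrite uu !mulrS mulr0n; ncring.
by lra.
Qed.

End Positivity.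

(** * Simple algebras have trivial center *)

Section Subalgebras.
Context {R : realType} {A : cstarAlgType R}.
Implicit Types (x y z : A) (N : set A).

(** Norm-closedness is left out so that commutants and images of [bc_incl] qualify by algebra
    alone. *)
Definition star_subalgebra N : Prop :=
  [/\ N 1, forall (c : R[i]) x y, N x -> N y -> N (c *: x + y),
      forall x y, N x -> N y -> N (x * y) & forall x, N x -> N (star x)].

Lemma cstar_star_subalgebra N : cstar_subalgebra N -> star_subalgebra N.
Proof. by case. Qed.

(** The form in which simplicity is used everywhere after this part; unlike simplicity, it passes
    easily to the basic construction. *)
Definition trivial_center N : Prop :=
  forall x, N x -> (forall y, N y -> x * y = y * x) -> exists c : R[i], x = c%:A.

Definition commutant N : set A := [set x | forall n, N n -> x * n = n * x].

Lemma star_subalgebra_setT : star_subalgebra [set: A].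
Proof. by split. Qed.

Section Closure.
Context (N : set A) (sN : star_subalgebra N).

Lemma subalg1 : N 1. Proof. by case: sN. Qed.

Lemma subalgM x y : N x -> N y -> N (x * y).
Proof. by case: sN => _ _ h _; apply: h. Qed.

Lemma subalg_star x : N x -> N (star x).
Proof. by case: sN => _ _ _; apply. Qed.

Lemma subalg0 : N 0.
Proof.
case: sN => N1 h _ _; have := h (-1) 1 1 N1 N1.
by rewrite scaleN1r addNr.
Qed.

Lemma subalgZ (c : R[i]) x : N x -> N (c *: x).
Proof. by move=> Nx; rewrite -[_ *: _]addr0; case: sN => _ h _ _; apply: h subalg0. Qed.

Lemma subalgD x y : N x -> N y -> N (x + y).
Proof. by move=> Nx Ny; rewrite -[x]scale1r; case: sN => _ h _ _; apply: h. Qed.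

Lemma subalgN x : N x -> N (- x).
Proof. by move=> Nx; rewrite -scaleN1r; apply: subalgZ. Qed.

Lemma subalgB x y : N x -> N y -> N (x - y).
Proof. by move=> Nx Ny; apply: subalgD => //; apply: subalgN. Qed.

Lemma commutant_star_subalgebra : star_subalgebra (commutant N).
Proof.
split; rewrite /commutant /=.
- by move=> n _; rewrite mul1r mulr1.
- move=> c x y xc yc n Nn.
  by rewrite mulrDl mulrDr -scalerAl -scalerAr xc// yc.
- by move=> x y xc yc n Nn; rewrite -mulrA yc// mulrA xc// mulrA.
- move=> x xc n Nn; rewrite -[n]starK -!starM xc//; exact: subalg_star.
Qed.

Lemma selfadjoint_decomp x : N x -> exists h k : A,
  [/\ star h = h, star k = k, N h, N k & x = h + 'i *: k].
Proof.
move=> Nx; have Nsx := subalg_star Nx.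
exists (2^-1%:C *: (x + star x)), (2^-1%:C *: ('i *: (star x - x))); split.
- by rewrite starZr starD starK addrC.
- by rewrite starZr star_scale_i starB starK -scalerN opprB.
- by apply: subalgZ; exact: subalgD.
- by apply/subalgZ/subalgZ; exact: subalgB.
- rewrite !scalerA ['i * _]mulrC -mulrA -expr2 sqrCi mulrN1 scaleNr -scalerBr.
  by rewrite (_ : _ - _ = x *+ 2) ?half_double// mulr2n; ncring.
Qed.

End Closure.

Section SimpleCenter.
Context (N : set A) (simN : simple_cstar_subalgebra N).

Let sN : star_subalgebra N.
Proof. by case: simN => /cstar_star_subalgebra. Qed.

(** Because z is central, its annihilator in N is a closed two-sided ideal, hence zero or all of
    N. *)
Lemma simple_annihilator z : N z -> (forall y, N y -> z * y = y * z) ->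
  forall x, N x -> z * x = 0 -> z = 0 \/ x = 0.
Proof.
move=> Nz zc x Nx zx; pose I := [set y | N y /\ z * y = 0].
have cI : closed_ideal N I.
  split; rewrite /I /=.
  - by move=> y [].
  - by rewrite mulr0; split; first exact: subalg0.
  - move=> u v [Nu zu] [Nv zv]; rewrite mulrDr zu zv addr0.
    by split => //; exact: subalgD.
  - move=> a u Na [Nu zu]; do !split; [exact: subalgM| |exact: subalgM|].
      by rewrite mulrA zc// -mulrA zu mulr0.
    by rewrite mulrA zu mul0r.
  - move=> u l Iu ul; split.
      by case: simN => -[_ _ _ _ +] _; apply; [|exact: ul] => n; case: (Iu n).
    apply: (norm_closed_eq (F := fun y => z * y) (K := cnorm z)) (ul) => /=.
      by move=> y1 y2; rewrite -mulrBr; exact: cnormM.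
    by move=> n; case: (Iu n).
have Ix : I x by [].
case: simN => _ /(_ I cI)[IE|IE]; first by right; move: Ix; rewrite IE.
by left; have : I 1 by [rewrite IE; exact: subalg1 sN]; case=> _; rewrite mulr1.
Qed.

(* With [v = 2 q - 1], the element [|v|] is central and
   [(|v| - v) (|v| + v) = 0], so that simplicity forces [|v| = v]. *)
Lemma central_contraction_double q : N q -> (forall y, N y -> q * y = y * q) ->
  star q = q -> cnorm q = 1 -> cnorm ((1 : A) - q) <= 1 ->
  cnorm (q + q - 1) = 1 /\ cnorm (1 - (q + q - 1)) <= 1.
Proof.
move=> Nq qc sq nq pq; have N1 := subalg1 sN.
have [v vE] : exists v : A, q + q - 1 = v by exists (q + q - 1).
rewrite vE.
have Nv : N v by rewrite -vE; apply: subalgB => //; exact: subalgD.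
have vc y : N y -> v * y = y * v.
  by move=> Ny; rewrite -vE !(mulrBl, mulrBr, mulrDl, mulrDr) qc// mul1r mulr1.
have sv : star v = v by rewrite -vE starB starD sq star1.
have s1q : star (1 - q) = 1 - q by rewrite starB star1 sq.
have [z [sz _ zE _ _]] := sqrt_exists s1q pq.
have {}zE : (1 - z) * (1 - z) = q by rewrite zE; ncring.
have s1z : star (1 - z) = 1 - z by rewrite starB star1 sz.
have nz : cnorm (1 - z) <= 1.
  rewrite -(@expr_le1 _ 2) ?cnorm_ge0// -cnorm_sqr_selfadjoint// zE.
  by rewrite nq.
have nv : cnorm v <= 1.
  by have := cnorm_chebyshev2 s1z nz; rewrite zE cnorm_distC vE.
have vv1 := cnorm_one_sub_sqr sv nv.
have svv : star (1 - v * v) = 1 - v * v by rewrite starB star1 starM sv.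
have [y [sy ny yE yc yN]] := sqrt_exists svv vv1.
have Ny : N y.
  by apply: yN; [case: simN|apply: subalgB => //; exact: subalgM].
have ycN x : N x -> x * y = y * x.
  move=> Nx; apply: yc; rewrite mulrBr mulrBl mulr1 mul1r.
  by rewrite -[v * v * x]mulrA (vc x)// [v * (x * v)]mulrA (vc x)// mulrA.
have h : (1 - y - v) * (1 - y + v) = 0.
  have -> : (1 - y - v) * (1 - y + v) =
      (1 - y) * (1 - y) - v * v + (v * y - y * v) by ncring.
  by rewrite yE ycN// subrr addr0; ncring.
have N1y : N (1 - y) by exact: subalgB.
(* 1 + v is 2 q. This excludes the alternative 1 + v = y, where y has norm at most 1, and forces
   [cnorm v] to be 1 in the other one. *)
have double : cnorm (1 + v) = 2.
  by rewrite -vE addrC subrK cnorm_double nq.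
have [|||e|e] := simple_annihilator _ _ _ h.
- exact: subalgB.
- by move=> x Nx; rewrite !(mulrBl, mulrBr) vc// ycN// mul1r mulr1.
- exact: subalgD.
- have -> : 1 - v = y.
    by apply/eqP; rewrite -subr_eq0 addrAC e.
  split=> //; apply/eqP; rewrite eq_le nv.
  by have := cnormD (1 : A) v; rewrite double cnorm1; lra.
- exfalso; have : 1 + v = y by apply/eqP; rewrite -subr_eq0 addrAC e.
  by move=> ve; move: ny; rewrite -ve double; lra.
Qed.

(** The map q |-> 2 q - 1 preserves all the hypotheses and doubles 1 - q. Iterating it would make
    the norm of 1 - q exceed 1 unless q = 1. *)
Lemma central_contraction_eq1 q : N q -> (forall y, N y -> q * y = y * q) ->
  star q = q -> cnorm q = 1 -> cnorm ((1 : A) - q) <= 1 -> q = 1.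
Proof.
move=> Nq qc sq nq pq; suff h n : (2 ^ n)%:R * cnorm (1 - q) <= 1.
  apply/eqP; rewrite eq_sym -subr_eq0; apply/eqP; apply: cnorm_small_eq0 => e e0.
  have [n] : exists n, e^-1 < n%:R.
    by exists (Num.truncn e^-1).+1; rewrite truncnS_gt.
  rewrite -div1r ltr_pdivrMr// => hn; rewrite leNgt; apply/negP => h1.
  have n2 : (n <= 2 ^ n)%N by apply: ltnW; exact: ltn_expl.
  move: (h n) n2; move: (2 ^ n)%N => m hm; rewrite -(ler_nat R) => nm.
  by have := ler_pM (ler0n R n) (ltW e0) nm (ltW h1); lra.
elim: n q Nq qc sq nq pq => [|n IH] q Nq qc sq nq pq.
  by rewrite mul1r.
have [nv pv] := central_contraction_double Nq qc sq nq pq.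
have N1 := subalg1 sN.
have := IH (q + q - 1); rewrite (_ : 1 - (q + q - 1) = (1 - q) + (1 - q)); last by ncring.
rewrite cnorm_double expnS natrM => h.
apply: le_trans (h _ _ _ _ _) => //.
- by rewrite le_eqVlt; apply/orP; left; apply/eqP; ring.
- by apply: subalgB => //; exact: subalgD.
- by move=> y Ny; rewrite !(mulrBl, mulrBr, mulrDl, mulrDr) qc// mul1r mulr1.
- by rewrite starB starD sq star1.
- by move: pv; rewrite (_ : 1 - (q + q - 1) = (1 - q) + (1 - q)) ?cnorm_double//; ncring.
Qed.

(** A self-adjoint central element scaled to norm 1 has square 1 by the doubling argument, so
    squares are scalars; polarization against 1 then treats the element itself. *)
Lemma simple_trivial_center : trivial_center N.
Proof.
have N1 := subalg1 sN.
have sqr x : N x -> (forall y, N y -> x * y = y * x) -> star x = x ->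
    exists r : R, x * x = r%:C%:A.
  move=> Nx xc sx; have [->|x0] := eqVneq x 0.
    by exists 0; rewrite mul0r scale0r.
  have nx := cnorm_neq0 x0; set r := cnorm x in nx.
  pose a := r^-1%:C *: x.
  have sa : star a = a by rewrite starZr sx.
  have na : cnorm a = 1.
    by rewrite cnormZr ger0_norm ?invr_ge0 ?ltW// mulVf// lt0r_neq0.
  have Na : N a by exact: subalgZ.
  have ac y : N y -> a * y = y * a by move=> Ny; rewrite -scalerAl -scalerAr xc.
  have aa : a * a = 1.
    apply: central_contraction_eq1.
    - exact: subalgM.
    - by move=> y Ny; rewrite -mulrA (ac y)// mulrA (ac y)// mulrA.
    - by rewrite starM sa.
    - by rewrite cnorm_sqr_selfadjoint// na expr1n.
    - by apply: cnorm_one_sub_sqr; rewrite ?na.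
  exists (r * r); have -> : x = r%:C *: a by rewrite /a scaleCKV ?lt0r_neq0.
  by rewrite -scalerAl -scalerAr aa scalerA -rmorphM.
have sa x : N x -> (forall y, N y -> x * y = y * x) -> star x = x ->
    exists r : R, x = r%:C%:A.
  move=> Nx xc sx; have [r rE] := sqr x Nx xc sx.
  (* 2 x = (x + 1)^2 - x^2 - 1 is a combination of scalars. *)
  have [|||t tE] := sqr (x + 1).
  - exact: subalgD.
  - by move=> y Ny; rewrite mulrDl mulrDr xc// mul1r mulr1.
  - by rewrite starD sx star1.
  exists (2^-1 * (t - r - 1)).
  have h : x *+ 2 = (t - r - 1)%:C%:A.
    rewrite !rmorphB rmorph1 !scalerBl scale1r -tE -rE mulr2n; ncring.
  by rewrite rmorphM -scalerA -h half_double.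
move=> x Nx xc.
have [h [k [sh sk [Nh hc] [Nk kc] xE]]] : exists h k : A, [/\ star h = h, star k = k,
    N h /\ (forall y, N y -> h * y = y * h), N k /\ (forall y, N y -> k * y = y * k) &
    x = h + 'i *: k].
  have cN : star_subalgebra (N `&` commutant N).
    have [c1 c2 c3 c4] := commutant_star_subalgebra sN.
    split; rewrite /setI /=.
    - by split.
    - by move=> c u v [? ?] [? ?]; split; [apply: (subalgD sN) => //; exact: subalgZ|exact: c2].
    - by move=> u v [? ?] [? ?]; split; [exact: subalgM|exact: c3].
    - by move=> u [? ?]; split; [exact: subalg_star|exact: c4].
  have [//|h [k [sh sk [Nh hc] [Nk kc] xE]]] := selfadjoint_decomp cN (x := x).
  by exists h, k.
rewrite xE; have [r ->] := sa h Nh hc sh; have [t ->] := sa k Nk kc sk.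
by exists (r%:C + 'i * t%:C); rewrite scalerDl scalerA.
Qed.

End SimpleCenter.
End Subalgebras.

(** * First variation of the index *)

Section ConditionalExpectationTheory.
Context {R : realType} {A : cstarAlgType R} (N : set A) (E : A -> A).
Context (sN : star_subalgebra N) (cE : conditional_expectation N E).
Implicit Types (x y z n : A) (s : seq A).

Lemma ceD x y : E (x + y) = E x + E y.
Proof. by case: cE => h _ _ _ _; rewrite -{1}[x]scale1r h scale1r. Qed.

Lemma ce0 : E 0 = 0.
Proof. by apply: (addrI (E 0)); rewrite -ceD !addr0. Qed.

Lemma ceZ (c : R[i]) x : E (c *: x) = c *: E x.
Proof. by case: cE => h _ _ _ _; rewrite -{1}[c *: x]addr0 h ce0 addr0. Qed.

Lemma ceN x : E (- x) = - E x.
Proof. by rewrite -scaleN1r ceZ scaleN1r. Qed.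

Lemma ceB x y : E (x - y) = E x - E y.
Proof. by rewrite ceD ceN. Qed.

Lemma ce_sum (I : Type) (r : seq I) (F : I -> A) :
  E (\sum_(i <- r) F i) = \sum_(i <- r) E (F i).
Proof. by elim/big_rec2: _ => [|i y1 y2 _ <-]; rewrite ?ce0 ?ceD. Qed.

Lemma ce_in x : N (E x).
Proof. by case: cE. Qed.

Lemma ce_id n : N n -> E n = n.
Proof. by case: cE => _ _ h _ _; exact: h. Qed.

Lemma ce_scalar (c : R[i]) : E c%:A = c%:A.
Proof. by apply: ce_id; apply: (subalgZ sN); exact: subalg1. Qed.

Lemma ce1 : E 1 = 1.
Proof. exact/ce_id/(subalg1 sN). Qed.

Lemma ceMl n x : N n -> E (n * x) = n * E x.
Proof.
case: cE => _ _ _ h _ Nn; have := h n x 1 Nn (subalg1 sN).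
by rewrite !mulr1.
Qed.

Lemma ceMr n x : N n -> E (x * n) = E x * n.
Proof.
case: cE => _ _ _ h _ Nn; have := h 1 x n (subalg1 sN) Nn.
by rewrite !mul1r.
Qed.

Lemma ce_star x : E (star x) = star (E x).
Proof.
have sqr a : star a = a -> star (E (a * a)) = E (a * a).
  move=> sa; case: cE => _ _ _ _ /(_ (a * a)) []; first by exists a; rewrite sa.
  by move=> y ->; rewrite starM starK.
have sa a : star a = a -> star (E a) = E a.
  move=> sa; have s1 : star (a + 1) = a + 1 by rewrite starD star1 sa.
  have s2 : star (a - 1) = a - 1 by rewrite starB star1 sa.
  (* Positivity of E controls only squares, so a self-adjoint a is written as a difference of two
     squares divided by 4. *)
  have h : a *+ 2 *+ 2 = (a + 1) * (a + 1) - (a - 1) * (a - 1).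
    by rewrite !mulr2n; ncring.
  have -> : a = 2^-1%:C *: (2^-1%:C *: (a *+ 2 *+ 2)) by rewrite !half_double.
  by rewrite h !ceZ ceB !starZr starB !sqr.
have [//|h [k [sh sk _ _ ->]]] := selfadjoint_decomp star_subalgebra_setT (x := x).
by rewrite starD star_scale_i !ceD ceN !ceZ sh sk starD star_scale_i !sa.
Qed.

Lemma ce_commutant_comm x n : commutant N x -> N n -> E x * n = n * E x.
Proof. by move=> xc Nn; rewrite -ceMr// xc// ceMl. Qed.

Lemma ce_commutant_scalar x : trivial_center N -> commutant N x ->
  exists c : R[i], E x = c%:A.
Proof.
by move=> tN xc; apply: tN (ce_in x) _ => n; exact: ce_commutant_comm.
Qed.

Lemma ce_sqr_ge0 x (c : R[i]) : E (star x * x) = c%:A -> 0 <= c.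
Proof.
move=> h; apply: (@scalar_positive R A); rewrite -h.
by case: cE => _ _ _ _; apply; exists x.
Qed.

Section QuasiBasis.
Context (s : seq A) (qs : quasi_basis E s).

Lemma quasi_basis_star x : x = \sum_(l <- s) E (x * l) * star l.
Proof.
rewrite -{1}[x]starK {1}(qs (star x)) star_sum; apply: eq_bigr => l _.
by rewrite starM -ce_star starM !starK.
Qed.

Lemma ce_nondeg_r x : (forall y, E (y * x) = 0) -> x = 0.
Proof. by move=> h; rewrite (qs x) big1// => l _; rewrite h mulr0. Qed.

Lemma ce_nondeg_l x : (forall y, E (x * y) = 0) -> x = 0.
Proof. by move=> h; rewrite (quasi_basis_star x) big1// => l _; rewrite h mul0r. Qed.

End QuasiBasis.

(** At 1 this is the Watatani index. On the commutant of N it takes central values and is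
    independent of the quasi-basis. *)
Definition index_map s x : A := \sum_(l <- s) l * x * star l.

Lemma index_mapD s x y : index_map s (x + y) = index_map s x + index_map s y.
Proof. by rewrite -big_split; apply: eq_bigr => l _; rewrite mulrDr mulrDl. Qed.

Lemma index_mapZ s (c : R[i]) x : index_map s (c *: x) = c *: index_map s x.
Proof. by rewrite scaler_sumr; apply: eq_bigr => l _; rewrite -scalerAr -scalerAl. Qed.

Lemma index_mapB s x y : index_map s (x - y) = index_map s x - index_map s y.
Proof. by rewrite index_mapD -scaleN1r index_mapZ scaleN1r. Qed.

Lemma index_map1 s : index_map s 1 = \sum_(l <- s) l * star l.
Proof. by apply: eq_bigr => l _; rewrite mulr1. Qed.

Lemma cnorm_index_map s : exists2 K, 0 <= K &
  forall x, cnorm (index_map s x) <= K * cnorm x.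
Proof.
exists (\sum_(l <- s) cnorm l * cnorm l).
  by apply: sumr_ge0 => l _; rewrite mulr_ge0 ?cnorm_ge0.
move=> x; apply: le_trans (cnorm_sum _ _) _; rewrite mulr_suml.
apply: ler_sum => l _; apply: le_trans (cnormM _ _) _.
rewrite cnorm_star mulrAC ler_wpM2r ?cnorm_ge0//.
exact: cnormM.
Qed.

(** Expand l^* in the other quasi-basis: the coefficients lie in N and pass through x. *)
Lemma index_map_change s s' x : quasi_basis E s -> quasi_basis E s' ->
  commutant N x -> index_map s x = index_map s' x.
Proof.
move=> qs qs' xc.
transitivity (\sum_(l <- s) \sum_(m <- s') l * E (star l * m) * x * star m).
  apply: eq_bigr => l _; rewrite {1}(quasi_basis_star qs' (star l)) mulr_sumr.
  apply: eq_bigr => m _; rewrite mulrA -[l * x * _]mulrA xc ?mulrA//.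
  exact: ce_in.
rewrite exchange_big; apply: eq_bigr => m _.
by rewrite -!mulr_suml -qs.
Qed.

Lemma index_map_comm s x m : quasi_basis E s -> commutant N x ->
  m * index_map s x = index_map s x * m.
Proof.
move=> qs xc.
transitivity (\sum_(l <- s) \sum_(k <- s) k * E (star k * (m * l)) * x * star l).
  rewrite mulr_sumr; apply: eq_bigr => l _.
  by rewrite !mulrA -[m * l]mulr1 -{1}[m * l]mulr1 {1}(qs (m * l)) !mulr1 !mulr_suml.
rewrite exchange_big mulr_suml; apply: eq_bigr => k _.
transitivity (\sum_(l <- s) k * x * (E (star k * m * l) * star l)).
  apply: eq_bigr => l _; rewrite !mulrA -[k * x * _]mulrA xc ?mulrA//.
  exact: ce_in.
by rewrite -mulr_sumr -quasi_basis_star// mulrA.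
Qed.

End ConditionalExpectationTheory.

Section FirstVariation.
Context {R : realType} {A : cstarAlgType R} (N : set A) (E : A -> A).
Context (sN : star_subalgebra N) (tN : trivial_center N).
Context (tA : trivial_center [set: A]) (minE : minimal_expectation N E).
Context (s : seq A) (qs : quasi_basis E s).
Implicit Types (x y z g : A).

Let cE : conditional_expectation N E. Proof. by case: minE. Qed.

(** The factor 1 + r is E((1 + z)^2), which makes [E'] unital. Its quasi-basis is that of E
    multiplied on the right by sqrt(1 + r) g, with g inverse to 1 + z. *)
Lemma perturbed_expectation z g (r : R) : commutant N z -> commutant N g ->
  star z = z -> star g = g -> E z = 0 -> E (z * z) = r%:C%:A -> 0 <= r ->
  (1 + z) * g = 1 -> g * (1 + z) = 1 ->
  let E' x := (1 + r)^-1%:C *: E ((1 + z) * x * (1 + z)) in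
  conditional_expectation N E' /\
  has_index E' ((1 + r)%:C *: index_map s (g * g)).
Proof.
move=> zc gc sz sg Ez Ezz r0.
have [a aE] : exists a, 1 + z = a by exists (1 + z).
rewrite aE => ag ga E'.
have rho0 : 0 < 1 + r by lra.
have rhoN : 1 + r != 0 by rewrite lt0r_neq0.
pose t := Num.sqrt (1 + r).
have tt : t * t = 1 + r by rewrite -expr2 sqr_sqrtr ?ltW.
have t0 : t != 0 by apply: contra_eq_neq tt => ->; rewrite mul0r eq_sym.
have sa : star a = a by rewrite -aE starD star1 sz.
have ac : commutant N a.
  by move=> n Nn; rewrite -aE mulrDl mulrDr mul1r mulr1 zc.
have Eaa : E (a * a) = (1 + r)%:C%:A.
  have -> : a * a = 1 + (z + z) + z * z by rewrite -aE; ncring.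
  by rewrite !(ceD cE) (ce1 sN cE) Ez Ezz !addr0 rmorphD rmorph1 scalerDl scale1r.
split.
  split.
  - move=> c x y; rewrite /E' mulrDr mulrDl (ceD cE) -scalerAr -scalerAl (ceZ cE).
    by rewrite scalerDr !scalerA [c * _]mulrC.
  - by move=> x; apply: subalgZ => //; exact: ce_in cE _.
  - move=> b Nb; rewrite /E' ac// -mulrA (ceMl sN cE)// Eaa -scalerAr mulr1.
    by rewrite scaleCVK.
  - move=> b x b' Nb Nb'; rewrite /E'.
    have -> : a * (b * x * b') * a = b * (a * x * a) * b'.
      by rewrite !mulrA (ac b)// -[_ * b' * a]mulrA -(ac b')// !mulrA.
    by rewrite (ceMr sN cE)// (ceMl sN cE)// -scalerAr -scalerAl.
  - move=> _ [y ->]; have [_ _ _ _ /(_ (star (y * a) * (y * a)))[]] := cE.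
      by exists (y * a).
    move=> w wE; exists (t^-1%:C *: w).
    rewrite starZr -scalerAl -scalerAr scalerA -rmorphM -invfM tt -wE /E'.
    by rewrite starM sa !mulrA.
exists [seq t%:C *: (l * g) | l <- s].
  move=> x; rewrite big_map.
  transitivity (\sum_(l <- s) l * E (star l * (x * a)) * g).
    by rewrite -mulr_suml -qs -mulrA ag mulr1.
  apply: eq_bigr => l _; rewrite starZr starM sg /E' -!(scalerAl, scalerAr).
  rewrite (ceZ cE) -!(scalerAl, scalerAr) !scalerA.
  rewrite [X in _ = X *: _](_ : _ = 1); last first.
    rewrite -!rmorphM -tt -[RHS](rmorph1 (real_complex R)).
    by congr (real_complex _ _); field.
  rewrite scale1r !mulrA ag mul1r -!mulrA gc ?mulrA//.
  exact: ce_in cE _.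
rewrite big_map scaler_sumr; apply: eq_bigr => l _.
by rewrite starZr -!(scalerAl, scalerAr) scalerA -rmorphM tt starM sg !mulrA.
Qed.

Lemma index_variation : exists2 K, 0 <= K &
  forall z (r : R), commutant N z -> star z = z -> E z = 0 ->
  E (z * z) = r%:C%:A -> 0 <= r -> cnorm z <= 2^-1 ->
  exists y (c : R[i]), [/\ 0 <= c, c%:A = y - (index_map s z + index_map s z) &
    cnorm y <= K * (r + r + (1 + r) * (16 * cnorm z ^+ 2))].
Proof.
have [K K0 hK] := cnorm_index_map s; exists K => // z r zc sz Ez Ezz r0 z2.
have [|g [ag ga g2]] := @neumann_inverse R A (- z); first by rewrite cnormN.
rewrite opprK in ag ga.
have sg : star g = g.
  have h : star g * (1 + z) = 1.
    by rewrite -[1 + z]starK starD star1 sz -starM ag star1.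
  by rewrite -[LHS]mulr1 -{1}ag mulrA h mul1r.
have gc : commutant N g.
  move=> n Nn; have zn : (1 + z) * n = n * (1 + z).
    by rewrite mulrDl mulrDr mul1r mulr1 zc.
  by rewrite -[LHS]mulr1 -ag mulrA -[g * n * _]mulrA -zn mulrA ga mul1r.
have [cE' iE'] := perturbed_expectation zc gc sz sg Ez Ezz r0 ag ga.
have cgg : commutant N (g * g) by apply: (subalgM (commutant_star_subalgebra sN)).
have c1 : commutant N 1 by move=> n _; rewrite mul1r mulr1.
have scal x : commutant N x -> exists c : R[i], index_map s x = c%:A.
  by move=> xc; apply: tA => // y _; rewrite -(index_map_comm cE).
have wE : exists2 w, has_index E w & positive ((1 + r)%:C *: index_map s (g * g) - w).
  by case: minE => _ [w iw /(_ _ _ cE' iE') hw]; exists w.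
have {wE} pos : positive ((1 + r)%:C *: index_map s (g * g) - index_map s 1).
  case: wE => w [s' qs' wE]; rewrite (index_map_change cE qs qs' c1).
  by rewrite index_map1 -wE.
(* (1 + z)^2 (1 - 2 z) = 1 - 3 z^2 - 2 z^3, so this is the exact remainder of (1 + z)^(-2) after its
   linear part. The bound 16 is 4 for g^2 times 3 + 1 for the bracket, using that z has norm at most
   1/2. *)
pose q := g * g * (z * z + z * z + z * z + (z * z * z + z * z * z)).
have ggE : g * g = 1 - (z + z) + q.
  have h : g * g * ((1 + z) * (1 + z)) = 1.
    by rewrite mulrA -[g * g * _]mulrA ga mulr1.
  transitivity (g * g * ((1 + z) * (1 + z)) * (1 - (z + z)) + q).
    by rewrite /q; ncring.
  by rewrite h mul1r.
have nq : cnorm q <= 16 * cnorm z ^+ 2.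
  have nz := cnorm_ge0 z; have ng := cnorm_ge0 g.
  have n1 : cnorm (g * g) <= 4.
    by apply: le_trans (cnormM _ _) _; have := ler_pM ng ng g2 g2; lra.
  have n2 : cnorm (z * z) <= cnorm z ^+ 2 by rewrite expr2 cnormM.
  have n3 : cnorm (z * z * z) <= 2^-1 * cnorm z ^+ 2.
    apply: le_trans (cnormM _ _) _; rewrite mulrC.
    by apply: ler_pM => //; exact: cnorm_ge0.
  apply: le_trans (cnormM _ _) _.
  rewrite (_ : 16 * _ = 4 * (4 * cnorm z ^+ 2)); last by ring.
  apply: ler_pM; rewrite ?cnorm_ge0//.
  have := cnormD (z * z + z * z + z * z) (z * z * z + z * z * z).
  have := cnormD (z * z + z * z) (z * z); have := cnormD (z * z) (z * z).
  have := cnormD (z * z * z) (z * z * z).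
  by lra.
have [c cE2] := scal _ cgg; have [d dE] := scal _ c1.
exists (r%:C *: (index_map s 1 - (index_map s z + index_map s z)) +
  (1 + r)%:C *: index_map s q), ((1 + r)%:C * c - d); split.
- apply: (@scalar_positive R A); move: pos.
  by rewrite cE2 dE scalerA -scalerBl.
- rewrite scalerBl -scalerA -cE2 -dE ggE index_mapD index_mapB index_mapD.
  by rewrite scalerDr rmorphD rmorph1 !scalerDl !scale1r; ncring.
- apply: le_trans (cnormD _ _) _.
  rewrite !cnormZr (ger0_norm r0) ger0_norm; last by lra.
  have := hK q; have := hK 1; have := hK z; rewrite cnorm1.
  have := cnormB (index_map s 1) (index_map s z + index_map s z).
  have := cnormD (index_map s z) (index_map s z) => h1 h2 h3 h4 h5.
  have e1 : cnorm (index_map s 1 - (index_map s z + index_map s z)) <= K + K.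
    by have := ler_wpM2l K0 z2; lra.
  have e2 : cnorm (index_map s q) <= K * (16 * cnorm z ^+ 2).
    by apply: le_trans h5 _; rewrite ler_wpM2l.
  have := ler_wpM2l r0 e1.
  have r1 : 0 <= 1 + r by lra.
  by have := ler_wpM2l r1 e2; lra.
Qed.

(** Along t k and -t k the index increases by scalars c and c', both nonnegative, whose linear terms
    cancel in the sum. So c is of order t^2, and then so is t times [index_map s k]; let t tend to
    0. *)
Lemma index_map_centered k : commutant N k -> star k = k -> E k = 0 ->
  index_map s k = 0.
Proof.
move=> kc sk Ek.
have ckk : commutant N (k * k) by apply: (subalgM (commutant_star_subalgebra sN)).
have [c0 cE0] := ce_commutant_scalar sN cE tN ckk.
have c00 : 0 <= c0 by apply: (@ce_sqr_ge0 _ _ _ _ cE k); rewrite sk.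
have /complex_realP [r rE] := ger0_real c00.
move: c00 cE0; rewrite {}rE ler0c => r0 Ekk.
have [K K0 hK] := index_variation.
set P := index_map s k.
pose M := K * (r + r + (1 + r) * (16 * cnorm k ^+ 2)).
have M0 : 0 <= M.
  by rewrite mulr_ge0// !addr_ge0// mulr_ge0 ?mulr_ge0 ?exprn_ge0 ?cnorm_ge0//; lra.
have var (t : R) : `|t| <= 1 -> `|t| * cnorm k <= 2^-1 -> exists y (c : R[i]),
    [/\ 0 <= c, c%:A = y - t%:C *: (P + P) & cnorm y <= t ^+ 2 * M].
  move=> t1 tk; have t2 : 0 <= t ^+ 2 <= 1.
    by rewrite sqr_ge0 -real_normK ?num_real// expr_le1.
  have [||||||y [c [c_ge0 cy ny]]] := hK (t%:C *: k) (t ^+ 2 * r).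
  - by move=> n Nn; rewrite -scalerAl -scalerAr kc.
  - by rewrite starZr sk.
  - by rewrite (ceZ cE) Ek scaler0.
  - by rewrite -scalerAl -scalerAr !(ceZ cE) Ekk !scalerA -!rmorphM expr2.
  - by rewrite mulr_ge0 ?sqr_ge0.
  - by rewrite cnormZr.
  exists y, c; split => //; first by rewrite cy !index_mapZ scalerDr.
  apply: le_trans ny _; rewrite cnormZr exprMn real_normK ?num_real// /M.
  rewrite [leRHS]mulrCA ler_wpM2l//.
  have k0 : 0 <= cnorm k ^+ 2 by rewrite exprn_ge0 ?cnorm_ge0.
  have : 0 <= r * cnorm k ^+ 2 by rewrite mulr_ge0.
  case/andP: t2 => t2 t3.
  have := mulr_ge0 t2 (mulr_ge0 (mulr_ge0 r0 k0) (_ : 0 <= 1 - t ^+ 2)).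
  by rewrite subr_ge0 => /(_ t3); lra.
apply: cnorm_small_eq0 => e e0.
(* The three bounds keep t^2 at most 1, give t k norm at most 1/2 as the Neumann series requires,
   and make 3 t M at most e. *)
pose t := Num.min 1 (Num.min (2^-1 / (cnorm k + 1)) (e / (3 * M + 1))).
have k1 : 0 < cnorm k + 1 by rewrite ltr_wpDl ?cnorm_ge0.
have M1 : 0 < 3 * M + 1 by lra.
have t0 : 0 < t by rewrite !lt_min ltr01 !divr_gt0 ?invr_gt0.
have t1 : t <= 1 by rewrite ge_min lexx.
have tk : t * cnorm k <= 2^-1.
  have : t <= 2^-1 / (cnorm k + 1) by rewrite !ge_min lexx orbT.
  by rewrite ler_pdivlMr// mulrDr mulr1; lra.
have tM : t * (3 * M + 1) <= e.
  have : t <= e / (3 * M + 1) by rewrite !ge_min lexx !orbT.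
  by rewrite ler_pdivlMr.
have [||y [c [c_ge0 cy ny]]] := var t; rewrite ?gtr0_norm//.
have [||y' [c' [c'_ge0 cy' ny']]] := var (- t); rewrite ?normrN ?gtr0_norm//.
rewrite sqrrN in ny'.
have nc : cnorm (c%:A : A) <= t ^+ 2 * M + t ^+ 2 * M.
  apply: (@le_trans _ _ (cnorm (c%:A + c'%:A : A))); last first.
    rewrite cy cy' rmorphN scaleNr opprK addrACA addNr addr0.
    by apply: le_trans (cnormD _ _) _; exact: lerD.
  rewrite -scalerDl; have /complex_realP [u uE] := ger0_real c_ge0.
  have /complex_realP [u' uE'] := ger0_real c'_ge0.
  move: c_ge0 c'_ge0; rewrite uE uE' !ler0c -rmorphD !cnorm_scalar => u0 u'0.
  by rewrite !ger0_norm ?addr_ge0//; lra.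
have h : t * (cnorm P + cnorm P) <= 3 * (t ^+ 2 * M).
  rewrite -cnorm_double -[X in X * _](gtr0_norm t0) -cnormZr.
  rewrite (_ : _ *: _ = y - c%:A); last by rewrite cy subKr.
  by apply: le_trans (cnormB _ _) _; lra.
have : t * (cnorm P + cnorm P) <= t * (3 * (t * M)).
  by move: h; rewrite (_ : 3 * _ = t * (3 * (t * M)))//; ring.
rewrite ler_pM2l// => h2.
have := cnorm_ge0 P; have tM0 : 0 <= t * M by rewrite mulr_ge0 // ltW.
by lra.
Qed.

Lemma minimal_index_map x : commutant N x -> index_map s x = index_map s 1 * E x.
Proof.
have sC := commutant_star_subalgebra sN.
have sa h : commutant N h -> star h = h -> index_map s h = index_map s 1 * E h.
  move=> hc sh; have [c cEh] := ce_commutant_scalar sN cE tN hc.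
  have : index_map s (h - c%:A) = 0.
    apply: index_map_centered.
    - by apply: (subalgB sC hc); apply: (subalgZ sC); exact: subalg1 sC.
    - by rewrite starB sh -cEh -(ce_star cE) sh.
    - by rewrite (ceB cE) cEh (ce_scalar sN cE) subrr.
  rewrite index_mapB index_mapZ cEh mulr_algr => /eqP.
  by rewrite subr_eq0 => /eqP.
move=> xc; have [h [k [sh sk hc kc ->]]] := selfadjoint_decomp sC xc.
by rewrite index_mapD index_mapZ (ceD cE) (ceZ cE) (sa h)// (sa k)// mulrDr scalerAr.
Qed.

End FirstVariation.

(** * Minimal expectations are traces on the commutant *)

Section MinimalTrace.
Context {R : realType} {A : cstarAlgType R} (N : set A) (E : A -> A).
Context (sN : star_subalgebra N) (tN : trivial_center N).
Context (tA : trivial_center [set: A]) (minE : minimal_expectation N E).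
Context (s : seq A) (qs : quasi_basis E s) (d : R[i]).
Context (dE : index_map s 1 = d%:A) (d0 : d != 0).
Context (faithE : forall y, commutant N y -> E (star y * y) = 0 -> y = 0).
Implicit Types (x y z : A).

Let cE : conditional_expectation N E. Proof. by case: minE. Qed.
Let sC := commutant_star_subalgebra sN.

(** The modular (Nakayama) automorphism of the form (x, y) |-> E (x y) on the commutant: it measures
    the failure of E to be a trace. *)
Definition modular_map x : A := \sum_(l <- s) E (l * x) * star l.

Lemma modular_mapP x z : commutant N x -> E (modular_map x * z) = E (z * x).
Proof.
move=> xc; rewrite mulr_suml (ce_sum cE) {2}(qs z) mulr_suml (ce_sum cE).
apply: eq_bigr => l _; have Nl := ce_in cE.
rewrite -mulrA (ceMl sN cE)// -(ceMr sN cE)// -mulrA xc ?mulrA//.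
Qed.

Lemma modular_mapB x y : modular_map (x - y) = modular_map x - modular_map y.
Proof.
by rewrite -sumrB; apply: eq_bigr => l _; rewrite mulrBr (ceB cE) mulrBl.
Qed.

Lemma modular_map_commutant x : commutant N x -> commutant N (modular_map x).
Proof.
move=> xc n Nn; apply/eqP; rewrite -subr_eq0; apply/eqP.
apply: (ce_nondeg_l cE qs) => y.
rewrite mulrBl -!mulrA (ceB cE) modular_mapP// -mulrA.
by rewrite !(ceMl sN cE _ Nn) modular_mapP// subrr.
Qed.

(** A second exchange rule for the modular map. Once [index_map s] is known to be a multiple of E,
    it can be compared with [modular_mapP], in which the modular map stands on the other side. *)
Lemma index_map_modular x y : commutant N x -> commutant N y ->
  index_map s (x * y) = index_map s (y * modular_map x).
Proof.
move=> xc yc.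
transitivity (\sum_(l <- s) \sum_(k <- s) k * E (star k * (l * x)) * y * star l).
  apply: eq_bigr => l _; rewrite mulrA {1}(qs (l * x)) !mulr_suml.
  by [].
rewrite exchange_big; apply: eq_bigr => k _.
transitivity (\sum_(l <- s) k * y * (E (modular_map x * star k * l) * star l)).
  apply: eq_bigr => l _; rewrite -[modular_map x * _ * l]mulrA modular_mapP//.
  by rewrite !mulrA -[k * y * _]mulrA yc ?mulrA//; exact: (ce_in cE).
by rewrite -mulr_sumr -(quasi_basis_star cE qs) !mulrA.
Qed.

(* Since [index_map s] is a multiple of [E] on the commutant, [modular_map] is an
   involution; being positive for [(x, y) |-> E (x^* y)], it is the identity. *)
Lemma minimal_tracial x y : commutant N x -> E (x * y) = E (y * x).
Proof.
have twist u v : commutant N u -> commutant N v ->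
    E (u * v) = E (v * modular_map u).
  move=> uc vc; have := index_map_modular uc vc.
  have mc := modular_map_commutant uc; have idx := minimal_index_map sN tN tA minE qs.
  rewrite (idx _ (subalgM sC uc vc)) (idx _ (subalgM sC vc mc)) dE !mulr_algl => /eqP.
  by rewrite -subr_eq0 -scalerBr scaler_eq0 (negbTE d0) /= subr_eq0 => /eqP.
have faith2 z : commutant N z -> E (z * star z) = 0 -> z = 0.
  move=> zc; rewrite -{1}[z]starK => /faithE h; rewrite -[z]starK h ?star0//.
  exact: (subalg_star sC).
have invol u : commutant N u -> modular_map (modular_map u) = u.
  move=> uc; have mc := modular_map_commutant uc.
  have mmc := modular_map_commutant mc.
  apply/eqP; rewrite eq_sym -subr_eq0; apply/eqP.
  have wc : commutant N (u - modular_map (modular_map u)) by exact: (subalgB sC).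
  apply: faith2 => //; have swc := subalg_star sC wc.
  by rewrite mulrBl (ceB cE) twist// modular_mapP// subrr.
move=> xc; have mc := modular_map_commutant xc.
suff mx : modular_map x = x by rewrite -{1}mx modular_mapP.
have zc : commutant N (x - modular_map x) by exact: (subalgB sC).
set z := x - modular_map x in zc.
have mz : modular_map z = - z by rewrite modular_mapB invol// opprB.
have szc := subalg_star sC zc.
have h : E (star z * z) = - E (z * star z).
  by rewrite -(modular_mapP _ zc) mz mulNr (ceN cE).
have [c cE1] := ce_commutant_scalar sN cE tN (subalgM sC szc zc).
have [c' cE2] := ce_commutant_scalar sN cE tN (subalgM sC zc szc).
have c_ge0 := ce_sqr_ge0 cE cE1.
have c'_ge0 : 0 <= c' by apply: (ce_sqr_ge0 cE (x := star z)); rewrite starK.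
have cc : c = - c' by apply: (@scalar_inj R A); rewrite -cE1 h cE2 scaleNr.
have c0 : c = 0.
  by apply/eqP; rewrite eq_le c_ge0 andbT cc oppr_le0.
have : z = 0 by apply: faithE => //; rewrite cE1 c0 scale0r.
by move/eqP; rewrite subr_eq0 => /eqP.
Qed.

End MinimalTrace.

Section Nondegenerate.
Context {R : realType} {A : cstarAlgType R} (N : set A) (E : A -> A).
Context (sN : star_subalgebra N) (tN : trivial_center N).
Context (cE : conditional_expectation N E).
Implicit Types (x y z : A).

Let sC := commutant_star_subalgebra sN.

Lemma ce_null_orthogonal y z : commutant N y -> commutant N z ->
  E (star y * y) = 0 -> E (star z * y) = 0.
Proof.
move=> yc zc Ey.
have szc := subalg_star sC zc.
have [c cE1] := ce_commutant_scalar sN cE tN (subalgM sC szc yc).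
have [e eE] := ce_commutant_scalar sN cE tN (subalgM sC szc zc).
have e_ge0 := ce_sqr_ge0 cE eE.
have [c00|c0] := eqVneq c 0; first by rewrite cE1 c00 scale0r.
(* Degenerate Cauchy-Schwarz: since E(y^* y) = 0, the value at t y + z is affine in t, and this t
   makes it e - (e + 1) = -1. *)
exfalso; pose t := - ((e + 1) / (2 * (c * c^*))) * c^*.
have cc0 : c * c^* != 0 by rewrite mulf_neq0// conjC_eq0.
have cj : E (star y * z) = (c^*)%:A.
  by rewrite -[star y * z]starK starM starK (ce_star cE) cE1 star_scalar.
have h : E (star (t *: y + z) * (t *: y + z)) = (e + (t * c + t^* * c^*))%:A.
  have sqrD (u v : A) : star (u + v) * (u + v) =
      star u * u + (star v * u + star u * v) + star v * v by rewrite starD; ncring.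
  rewrite sqrD starZ -!(scalerAl, scalerAr) !(ceD cE) !(ceZ cE) Ey !scaler0 add0r.
  by rewrite cE1 cj eE !scalerA -!scalerDl addrC.
have := ce_sqr_ge0 cE h.
have er : e \is Num.real := ger0_real e_ge0.
have tc : t * c = - ((e + 1) / 2).
  rewrite /t -mulrA [c^* * c]mulrC mulNr; congr (- _).
  by move: (c * c^*) cc0 => w w0; field.
have -> : t^* * c^* = t * c.
  rewrite -rmorphM tc; apply: conj_Creal.
  by rewrite rpredN rpredM ?rpredD ?rpredV ?rpred1 ?rpred_nat.
have -> : e + (t * c + t * c) = -1 by rewrite tc; field.
by rewrite oppr_ge0 ler10.
Qed.

End Nondegenerate.

(** * The basic construction *)

Section BasicConstructionTheory.
Context {R : realType} {A : cstarAlgType R} (N : set A) (E : A -> A).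
Context (sN : star_subalgebra N) (cE : conditional_expectation N E).
Context (s : seq A) (qs : quasi_basis E s) (M : basic_construction N E).
Implicit Types (a b n : A) (x y z : M).

Local Notation i := (bc_incl M).
Local Notation e := (bc_jones M).
Local Notation act := (bc_act M).

Lemma bc_ext x y : (forall a, act x a = act y a) -> x = y.
Proof. by move=> h; apply: (@bc_act_inj _ _ _ _ M); apply/funext. Qed.

Lemma bc_actDl x y a : act (x + y) a = act x a + act y a.
Proof. by rewrite -[x]scale1r bc_actP !scale1r. Qed.

Lemma bc_act0l a : act 0 a = 0.
Proof. by apply: (addrI (act 0 a)); rewrite -bc_actDl !addr0. Qed.

Lemma bc_actZl (c : R[i]) x a : act (c *: x) a = c *: act x a.
Proof. by rewrite -[c *: x]addr0 bc_actP bc_act0l addr0. Qed.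

Lemma bc_act_suml (I : Type) (r : seq I) (F : I -> M) a :
  act (\sum_(j <- r) F j) a = \sum_(j <- r) act (F j) a.
Proof. by elim/big_rec2: _ => [|j y1 y2 _ <-]; rewrite ?bc_act0l ?bc_actDl. Qed.

Lemma bc_actDr x a b : act x (a + b) = act x a + act x b.
Proof. by have [h _] := bc_act_module x; exact: h. Qed.

Lemma bc_act0r x : act x 0 = 0.
Proof. by apply: (addrI (act x 0)); rewrite -bc_actDr !addr0. Qed.

Lemma bc_act_sumr (I : Type) (r : seq I) (F : I -> A) x :
  act x (\sum_(j <- r) F j) = \sum_(j <- r) act x (F j).
Proof. by elim/big_rec2: _ => [|j y1 y2 _ <-]; rewrite ?bc_act0r ?bc_actDr. Qed.

Lemma bc_actMr x a n : N n -> act x (a * n) = act x a * n.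
Proof. by have [_ h] := bc_act_module x; exact: h. Qed.

Lemma bc_inclD a b : i (a + b) = i a + i b.
Proof. by apply: bc_ext => u; rewrite bc_actDl !bc_inclP mulrDl. Qed.

Lemma bc_incl0 : i 0 = 0.
Proof. by apply: (addrI (i 0)); rewrite -bc_inclD !addr0. Qed.

Lemma bc_inclZ (c : R[i]) a : i (c *: a) = c *: i a.
Proof. by apply: bc_ext => u; rewrite bc_actZl !bc_inclP scalerAl. Qed.

Lemma bc_inclB a b : i (a - b) = i a - i b.
Proof. by rewrite bc_inclD -scaleN1r bc_inclZ scaleN1r. Qed.

Lemma bc_incl_sum (I : Type) (r : seq I) (F : I -> A) :
  i (\sum_(j <- r) F j) = \sum_(j <- r) i (F j).
Proof. by elim/big_rec2: _ => [|j y1 y2 _ <-]; rewrite ?bc_incl0 ?bc_inclD. Qed.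

Lemma bc_incl1 : i 1 = 1.
Proof. by apply: bc_ext => u; rewrite bc_inclP bc_act1 mul1r. Qed.

Lemma bc_incl_scalar (c : R[i]) : i c%:A = c%:A.
Proof. by rewrite bc_inclZ bc_incl1. Qed.

Lemma bc_inclM a b : i (a * b) = i a * i b.
Proof. by apply: bc_ext => u; rewrite bc_actM !bc_inclP mulrA. Qed.

Lemma bc_incl_inj : injective i.
Proof. by move=> a b /(congr1 (act ^~ 1)); rewrite !bc_inclP !mulr1. Qed.

Lemma bc_act_starP x (S : A -> A) :
  (forall a b, E (star (act x a) * b) = E (star a * S b)) ->
  forall b, act (star x) b = S b.
Proof.
move=> h b; apply/eqP; rewrite -subr_eq0; apply/eqP.
apply: (ce_nondeg_r qs) => y.
by rewrite -[y]starK mulrBr (ceB cE) -(bc_act_star x) h subrr.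
Qed.

Lemma bc_incl_star a : i (star a) = star (i a).
Proof.
apply: bc_ext => u; rewrite bc_inclP; symmetry; move: u.
by apply: bc_act_starP => u v; rewrite bc_inclP starM mulrA.
Qed.

Lemma bc_jones_star : star e = e.
Proof.
apply: bc_ext => u; rewrite [RHS]bc_jonesP; move: u.
apply: bc_act_starP => u v; rewrite bc_jonesP -(ce_star cE).
by rewrite (ceMl sN cE) ?(ceMr sN cE)//; exact: (ce_in cE).
Qed.

Lemma bc_jones_idem : e * e = e.
Proof. by apply: bc_ext => u; rewrite bc_actM !bc_jonesP (ce_id cE)//; exact: (ce_in cE). Qed.

Lemma bc_jones_comm n : N n -> i n * e = e * i n.
Proof.
by move=> Nn; apply: bc_ext => u; rewrite !(bc_actM, bc_inclP, bc_jonesP) (ceMl sN cE).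
Qed.

Lemma bc_jones_cutdown a : e * i a * e = i (E a) * e.
Proof.
apply: bc_ext => u; rewrite !(bc_actM, bc_inclP, bc_jonesP) (ceMr sN cE)//.
exact: (ce_in cE).
Qed.

(** A finite quasi-basis makes every adjointable map a finite sum of terms a e b, so identities in
    the basic construction can be checked on such terms without a limit. *)
Lemma bc_expand x : x = \sum_(l <- s) i (act x l) * e * i (star l).
Proof.
apply: bc_ext => u; rewrite bc_act_suml {1}(qs u) bc_act_sumr.
apply: eq_bigr => l _; rewrite !(bc_actM, bc_inclP, bc_jonesP) bc_actMr//.
exact: (ce_in cE).
Qed.

Lemma bc_sum1 : \sum_(l <- s) i l * e * i (star l) = 1.
Proof. by rewrite [RHS]bc_expand; apply: eq_bigr => l _; rewrite bc_act1. Qed.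

Lemma bc_mul_incl_jones x a : x * i a * e = i (act x a) * e.
Proof.
apply: bc_ext => u; rewrite !(bc_actM, bc_inclP, bc_jonesP) bc_actMr//.
exact: (ce_in cE).
Qed.

Lemma bc_mul_jones x : x * e = i (act x 1) * e.
Proof. by rewrite -bc_mul_incl_jones bc_incl1 mulr1. Qed.

Lemma bc_incl_jones_eq0 a : i a * e = 0 -> a = 0.
Proof.
move=> /(congr1 (act ^~ 1)).
by rewrite bc_act0l bc_actM bc_inclP bc_jonesP (ce1 sN cE) mulr1.
Qed.

(** The element i(a) e has e i(a^* a) e = i(E(a^* a)) e as its square, so the C*-identity in the
    basic construction applies. *)
Lemma ce_faithful a : E (star a * a) = 0 -> a = 0.
Proof.
move=> Ea; apply: bc_incl_jones_eq0; apply: cstar_eq0; rewrite starM bc_jones_star -bc_incl_star.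
by rewrite mulrA -[e * _ * _]mulrA -bc_inclM bc_jones_cutdown Ea bc_incl0 mul0r.
Qed.

Lemma bc_incl_star_subalgebra : star_subalgebra (range i).
Proof.
split.
- by exists 1 => //; rewrite bc_incl1.
- by move=> c _ _ [u _ <-] [v _ <-]; exists (c *: u + v) => //; rewrite bc_inclD bc_inclZ.
- by move=> _ _ [u _ <-] [v _ <-]; exists (u * v) => //; rewrite bc_inclM.
- by move=> _ [u _ <-]; exists (star u) => //; rewrite bc_incl_star.
Qed.

Lemma bc_incl_trivial_center : trivial_center [set: A] -> trivial_center (range i).
Proof.
move=> tA _ [a _ <-] h; have [//|u|c ->] := tA a.
  move=> _; apply: bc_incl_inj; rewrite !bc_inclM; apply: h.
  by exists u.
by exists c; rewrite bc_incl_scalar.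
Qed.

(** Commuting with A makes x right multiplication by [act x 1]; commuting with e places that element
    in N, where it is central by right N-linearity. *)
Lemma bc_trivial_center : trivial_center N -> trivial_center [set: M].
Proof.
move=> tN x _ xc; have xE a : act x a = a * act x 1.
  by have /(congr1 (act ^~ 1)) := xc (i a) I; rewrite !bc_actM !bc_inclP mulr1.
have Nx : N (act x 1).
  have /(congr1 (act ^~ 1)) := xc e I.
  by rewrite !bc_actM !bc_jonesP (ce1 sN cE) => ->; exact: (ce_in cE).
have [//|n Nn|c cE'] := tN (act x 1).
  by rewrite -bc_actMr// mul1r xE.
by exists c; apply: bc_ext => a; rewrite xE cE' bc_actZl bc_act1 mulr_algr.
Qed.

Section ExpectationDown.
Context (E1 : M -> A) (cE1 : conditional_expectation (range i) (i \o E1)).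

Lemma bc_ceZ (c : R[i]) x : E1 (c *: x) = c *: E1 x.
Proof. by apply: bc_incl_inj; rewrite bc_inclZ; exact: (ceZ cE1). Qed.

Lemma bc_ce_sum (I : Type) (r : seq I) (F : I -> M) :
  E1 (\sum_(j <- r) F j) = \sum_(j <- r) E1 (F j).
Proof. by apply: bc_incl_inj; rewrite bc_incl_sum; exact: (ce_sum cE1). Qed.

Lemma bc_ce_star x : E1 (star x) = star (E1 x).
Proof. by apply: bc_incl_inj; rewrite bc_incl_star; exact: (ce_star cE1). Qed.

Lemma bc_ce_incl a : E1 (i a) = a.
Proof. by apply: bc_incl_inj; apply: (ce_id cE1); exists a. Qed.

Lemma bc_ce1 : E1 1 = 1.
Proof. by rewrite -bc_incl1 bc_ce_incl. Qed.

Lemma bc_ceMl a x : E1 (i a * x) = a * E1 x.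
Proof.
apply: bc_incl_inj; rewrite bc_inclM.
by apply: (ceMl bc_incl_star_subalgebra cE1); exists a.
Qed.

Lemma bc_ceMr x a : E1 (x * i a) = E1 x * a.
Proof.
apply: bc_incl_inj; rewrite bc_inclM.
by apply: (ceMr bc_incl_star_subalgebra cE1); exists a.
Qed.

Lemma bc_ce_jones_commutant : commutant N (E1 e).
Proof. by move=> n Nn; rewrite -bc_ceMr -bc_jones_comm// bc_ceMl. Qed.

Lemma bc_ceE x : E1 x = \sum_(l <- s) act x l * E1 e * star l.
Proof.
rewrite {1}(bc_expand x) bc_ce_sum; apply: eq_bigr => l _.
by rewrite bc_ceMr bc_ceMl.
Qed.

Lemma bc_ce_mul_jones x a : E1 (x * i a * e) = act x a * E1 e.
Proof. by rewrite bc_mul_incl_jones bc_ceMl. Qed.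

Lemma index_map_ce_jones : index_map s (E1 e) = 1.
Proof.
rewrite -bc_ce1 (bc_ceE 1); apply: eq_bigr => l _.
by rewrite bc_act1.
Qed.

End ExpectationDown.
End BasicConstructionTheory.

(** * The minimal expectation of a basic construction *)

Section DualExpectation.
Context {R : realType} {A : cstarAlgType R} (N : set A) (E : A -> A).
Context (sN : star_subalgebra N) (tN : trivial_center N).
Context (tA : trivial_center [set: A]) (minE : minimal_expectation N E).
Context (s : seq A) (qs : quasi_basis E s) (d : R).
Context (dE : index_map s 1 = d%:C%:A) (M : basic_construction N E).
Context (E1 : M -> A).

Local Notation i := (bc_incl M).
Local Notation e := (bc_jones M).
Local Notation act := (bc_act M).
Local Notation f := (E1 e).
Local Notation rangei := (range i).

Context (minE1 : minimal_expectation rangei (i \o E1)).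
Implicit Types (a b n y : A) (x z : M).

Let cE : conditional_expectation N E. Proof. by case: minE. Qed.
Let cE1 : conditional_expectation rangei (i \o E1). Proof. by case: minE1. Qed.
Let sC := commutant_star_subalgebra sN.
Let sI : star_subalgebra rangei := bc_incl_star_subalgebra cE qs M.
Let tI : trivial_center rangei := @bc_incl_trivial_center _ _ _ _ M tA.
Let tM : trivial_center [set: M] := bc_trivial_center sN cE tN.
Let fc : commutant N f := bc_ce_jones_commutant sN cE qs cE1.

Let sf : star f = f.
Proof. by rewrite -(bc_ce_star cE qs cE1) (bc_jones_star sN cE qs). Qed.

Lemma index_mul_ce_jones : d%:C *: E f = 1.
Proof.
rewrite -mulr_algl -dE -(minimal_index_map sN tN tA minE qs)//.
exact: (index_map_ce_jones cE qs cE1).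
Qed.

Lemma index_neq0 : d != 0.
Proof.
apply/eqP => d0; have := index_mul_ce_jones; rewrite d0 scale0r => /eqP.
by rewrite eq_sym oner_eq0.
Qed.

Let dC0 : d%:C != 0 :> R[i].
Proof. by have := index_neq0; apply: contra_neq => /complexI. Qed.

Lemma ce_ce_jones : E f = d^-1%:C%:A.
Proof. by rewrite -index_mul_ce_jones scaleCVK ?index_neq0. Qed.

Lemma ce_tracial a b : commutant N a -> E (a * b) = E (b * a).
Proof.
apply: (minimal_tracial sN tN tA minE qs dE dC0) => y _.
exact: (ce_faithful sN cE qs M).
Qed.

(** Traciality is exactly what makes right multiplication by y^* an adjoint of right multiplication
    by y. *)
Lemma right_mul_exists y : commutant N y -> exists x, forall a, act x a = a * y.
Proof.
move=> yc; have [] := @bc_act_surj _ _ _ _ M (fun a => a * y) (fun a => a * star y).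
- by split=> [u v|u n Nn]; rewrite ?mulrDl// -!mulrA yc.
- split=> [u v|u n Nn]; rewrite ?mulrDl// -!mulrA.
  by rewrite (subalg_star sC).
- move=> u v; rewrite starM -mulrA ce_tracial ?mulrA//.
  exact: (subalg_star sC).
by move=> x xE; exists x => a; rewrite xE.
Qed.

Lemma commutant_inclP x : commutant rangei x ->
  commutant N (act x 1) /\ forall a, act x a = a * act x 1.
Proof.
move=> xc; have xE a : act x a = a * act x 1.
  have /(congr1 (act ^~ 1)) : x * i a = i a * x by apply: xc; exists a.
  by rewrite !bc_actM !bc_inclP mulr1.
by split=> // n Nn; rewrite -bc_actMr// mul1r xE.
Qed.

Lemma right_mul_commutant x y : (forall a, act x a = a * y) -> commutant rangei x.
Proof.
move=> h _ [a _ <-]; apply: bc_ext => u.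
by rewrite !bc_actM !bc_inclP !h mulrA.
Qed.

Lemma right_mul_star x y : commutant N y -> (forall a, act x a = a * y) ->
  forall a, act (star x) a = a * star y.
Proof.
move=> yc h; apply: (bc_act_starP cE qs) => a b.
by rewrite h starM -mulrA ce_tracial ?mulrA//; exact: (subalg_star sC).
Qed.

Lemma bc_ce_right_mul x y : commutant N y -> (forall a, act x a = a * y) ->
  E1 x = d%:C *: E (y * f).
Proof.
move=> yc h; rewrite (bc_ceE cE qs cE1).
rewrite -mulr_algl -dE -(minimal_index_map sN tN tA minE qs); last exact: (subalgM sC).
by apply: eq_bigr => l _; rewrite h mulrA.
Qed.

(** Expand e i(y) in a quasi-basis of the dual expectation: each coefficient contains the factor f
    y. *)
Lemma jones_regular y : f * y = 0 -> y = 0.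
Proof.
move=> fy; have [_ [w [v qv _] _]] := minE1.
have ey : e * i y = 0.
  rewrite (qv (e * i y)) big1// => k _ /=.
  rewrite mulrA (bc_ceMr cE qs cE1) -[star k]mulr1 -(bc_incl1 M).
  by rewrite (bc_ce_mul_jones cE qs cE1) -mulrA fy mulr0 bc_incl0 mulr0.
have /(congr1 star) : e * i y = 0 by [].
rewrite starM star0 (bc_jones_star sN cE qs) -(bc_incl_star cE qs).
by move=> /(bc_incl_jones_eq0 sN cE) h; rewrite -[y]starK h star0.
Qed.

(** Let x be right multiplication by y. A null vector is orthogonal to everything, in particular to
    right multiplication by f y, and that pairing is d E((f y)^* f y). *)
Lemma bc_ce_faithful x : commutant rangei x ->
  (i \o E1) (star x * x) = 0 -> x = 0.
Proof.
move=> xc Ex; have [yc xE] := commutant_inclP xc; set y := act x 1 in yc xE.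
suff y0 : y = 0 by apply: bc_ext => a; rewrite xE y0 mulr0 bc_act0l.
apply: jones_regular; apply: (ce_faithful sN cE qs M).
have wc : commutant N (f * y) by exact: (subalgM sC).
have [z zE] := right_mul_exists wc; have zc := right_mul_commutant zE.
have swc := subalg_star sC wc.
have zxE a : act (star z * x) a = a * (y * star (f * y)).
  by rewrite bc_actM xE (right_mul_star wc zE) mulrA.
have /(@bc_incl_inj _ _ _ _ M) : i (E1 (star z * x)) = i 0.
  by rewrite bc_incl0; exact: (ce_null_orthogonal sI tI cE1).
rewrite (bc_ce_right_mul _ zxE); last exact: (subalgM sC).
move=> /eqP; rewrite scaler_eq0 (negbTE dC0) /= => /eqP.
by rewrite -mulrA ce_tracial// -mulrA.
Qed.

Section DualIndex.
Context (v : seq M) (qv : quasi_basis (i \o E1) v).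

(** The factor f in z lets b y f be read as E1(x b e). Moving x to the right by [tr] turns the sum
    into the quasi-basis expansion of a e x, whose value at 1 is a E(y). *)
Lemma index_map_right_mul x y z : commutant N y ->
  (forall a, act x a = a * y) -> (forall a, act z a = a * (y * f)) ->
  (forall u, E1 (x * u) = E1 (u * x)) -> index_map v z = i (E y).
Proof.
move=> yc xE zE tr; apply: bc_ext => a; rewrite bc_inclP.
have [c cEy] := ce_commutant_scalar sN cE tN yc.
transitivity (act (\sum_(k <- v) k * i (E1 (star k * (i a * e * x)))) 1).
  rewrite !bc_act_suml; apply: eq_bigr => k _.
  rewrite !bc_actM zE bc_inclP mulr1; congr (act _ _).
  rewrite mulrA -xE -bc_actM -(bc_ce_mul_jones cE qs cE1) -!mulrA tr !mulrA.
  by [].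
rewrite -(qv (i a * e * x)) !bc_actM bc_inclP bc_jonesP xE mul1r.
by rewrite cEy mulr_algl mulr_algr.
Qed.

(** Were the index zero, minimality would annihilate [index_map v] on right multiplication by f,
    where its value is i(E 1) = 1. *)
Lemma dual_index_scalar : exists2 c : R[i], index_map v 1 = c%:A & c != 0.
Proof.
have c1 : commutant rangei 1 by move=> n _; rewrite mul1r mulr1.
have [//||c cE'] := tM (x := index_map v 1).
  by move=> u _; rewrite -(index_map_comm cE1).
exists c => //; apply/eqP => c0.
have [z zE] := right_mul_exists fc.
have zc := right_mul_commutant zE.
have := minimal_index_map sI tI tM minE1 qv zc.
rewrite (@index_map_right_mul 1 1 z) ?cE' ?c0 ?scale0r ?mul0r ?(ce1 sN cE).
- by move=> /eqP; rewrite bc_incl1 oner_eq0.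
- exact: (subalg1 sC).
- by move=> a; rewrite bc_act1 mulr1.
- by move=> a; rewrite mul1r.
- by move=> u; rewrite mul1r mulr1.
Qed.

(** Evaluate [index_map v] on right multiplication by y f: directly it is E(y), by minimality it is
    c d E(y f^2). Faithfulness removes y. *)
Lemma ce_jones_sqr c : index_map v 1 = c%:A -> (c * d%:C) *: (f * f) = 1.
Proof.
move=> cE'; have c0 : c != 0.
  have [c' cE'' ] := dual_index_scalar; rewrite cE' in cE''.
  by rewrite (scalar_inj cE'').
have tr x u : commutant rangei x -> E1 (x * u) = E1 (u * x).
  move=> xc; apply: (@bc_incl_inj _ _ _ _ M).
  apply: (minimal_tracial sI tI tM minE1 qv cE' c0) => // y.
  exact: bc_ce_faithful.
have ffc := subalgM sC fc fc.
have key y : commutant N y -> E y = (c * d%:C) *: E (y * (f * f)).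
  move=> yc; have yfc := subalgM sC yc fc.
  have [x xE] := right_mul_exists yc; have [z zE] := right_mul_exists yfc.
  have xc := right_mul_commutant xE; have zc := right_mul_commutant zE.
  have := index_map_right_mul yc xE zE (fun u => tr x u xc).
  rewrite (minimal_index_map sI tI tM minE1 qv zc) cE' mulr_algl /=.
  rewrite (bc_ce_right_mul yfc zE) -bc_inclZ => /(@bc_incl_inj _ _ _ _ M) <-.
  by rewrite scalerA mulrA.
set w := (c * d%:C) *: (f * f).
have wc : commutant N (1 - w).
  by apply: (subalgB sC); [exact: (subalg1 sC)|exact: (subalgZ sC)].
have : E (star (1 - w) * (1 - w)) = 0.
  rewrite mulrBr mulr1 (ceB cE) (key _ (subalg_star sC wc)) -(ceZ cE) -scalerAr.
  by rewrite subrr.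
by move=> /(ce_faithful sN cE qs M) /eqP; rewrite subr_eq0 => /eqP.
Qed.

End DualIndex.

(* [f^2] is a scalar [g]; positivity of [E] at [f - 1/d] gives [1/d^2 <= g], and
   positivity of [E1] at the right multiplication by [g d - f] the converse. *)
Lemma ce_jones : f = d^-1%:C%:A.
Proof.
have [_ [_ [v qv _] _]] := minE1.
have [c cE' c0] := dual_index_scalar qv.
have ff := ce_jones_sqr qv cE'.
have cd0 : c * d%:C != 0 by rewrite mulf_neq0.
have ffE : f * f = (c * d%:C)^-1%:A by rewrite -ff scalerA mulVf ?scale1r.
have : 0 <= (c * d%:C)^-1.
  apply: (ce_sqr_ge0 cE (x := f)); rewrite sf ffE.
  exact: (ce_scalar sN cE).
have : (c * d%:C)^-1 != 0 by rewrite invr_eq0.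
move: {ff cd0} ((c * d%:C)^-1) ffE => g0 + + g0_ge0.
have /complex_realP [g ->] := ger0_real g0_ge0.
move=> ffE gC0 {g0 g0_ge0}.
have d0 := index_neq0.
have sqrB (t : R) : (f - t%:C%:A) * (f - t%:C%:A) =
    (g + t * t)%:C%:A - (t + t)%:C *: f.
  rewrite mulrBl !mulrBr mulr_algr !mulr_algl ffE.
  by rewrite !rmorphD rmorphM !scalerDl -!scalerA; ncring.
have Eww : E ((f - d^-1%:C%:A) * (f - d^-1%:C%:A)) = (g - d^-1 ^+ 2)%:C%:A.
  rewrite sqrB (ceB cE) !(ceZ cE) (ce1 sN cE) ce_ce_jones scalerA.
  rewrite -rmorphM -scalerBl -rmorphB.
  by congr ((real_complex _ _) *: _); field.
have sw : star (f - d^-1%:C%:A) = f - d^-1%:C%:A.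
  by rewrite starB sf starZr star1.
have g1 : 0 <= g - d^-1 ^+ 2.
  by rewrite -ler0c; apply: (ce_sqr_ge0 cE (x := f - d^-1%:C%:A)); rewrite sw.
pose y := (g * d)%:C%:A - f.
have sy : star y = y by rewrite starB sf starZr star1.
have yc : commutant N y.
  by apply: (subalgB sC) => //; apply: (subalgZ sC); exact: (subalg1 sC).
have [x xE] := right_mul_exists yc.
have yyc := subalgM sC yc yc.
have xxE a : act (star x * x) a = a * (y * y).
  by rewrite bc_actM xE (right_mul_star yc xE) sy mulrA.
have E1xx : E1 (star x * x) = (g - g ^+ 2 * d ^+ 2)%:C%:A.
  rewrite (bc_ce_right_mul yyc xxE).
  have -> : y * y * f =
      (g + g * d * (g * d))%:C *: f - (g * d + g * d)%:C *: g%:C%:A.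
    have -> : y * y = (f - (g * d)%:C%:A) * (f - (g * d)%:C%:A).
      by rewrite /y -[_ - f]opprB mulrNN.
    by rewrite sqrB mulrBl mulr_algl -(scalerAl _ f f) ffE.
  rewrite (ceB cE) !(ceZ cE) (ce1 sN cE) ce_ce_jones !scalerA -!rmorphM.
  rewrite -scalerBl scalerA -rmorphB -rmorphM.
  by congr ((real_complex _ _) *: _); field.
have g2 : 0 <= g - g ^+ 2 * d ^+ 2.
  rewrite -ler0c; apply: (ce_sqr_ge0 cE1 (x := x)).
  by rewrite /= E1xx bc_incl_scalar.
have g0 : 0 < g.
  rewrite lt_neqAle; apply/andP; split.
    by apply: contra_neq gC0 => <-.
  by apply: le_trans (_ : d^-1 ^+ 2 <= g); [exact: sqr_ge0|rewrite -subr_ge0].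
have gE : g = d^-1 ^+ 2.
  apply/eqP; rewrite eq_le -[X in _ && X]subr_ge0 g1 andbT.
  rewrite exprVn -div1r ler_pdivlMr ?exprn_even_gt0//.
  rewrite -(ler_pM2l g0); lra.
have : E (star (f - d^-1%:C%:A) * (f - d^-1%:C%:A)) = 0.
  by rewrite sw Eww gE subrr scale0r.
by move=> /(ce_faithful sN cE qs M) /eqP; rewrite subr_eq0 => /eqP.
Qed.

Lemma dual_index v : quasi_basis (i \o E1) v -> index_map v 1 = d%:C%:A.
Proof.
move=> qv; have [c cE' c0] := dual_index_scalar qv.
have := ce_jones_sqr qv cE'; rewrite ce_jones mulr_algl !scalerA => h.
rewrite cE'; congr (_ *: _).
have : (c * d%:C * d^-1%:C * d^-1%:C)%:A = 1%:A :> A by rewrite scale1r.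
move=> /scalar_inj; rewrite -[c * _ * _]mulrA -rmorphM divff ?index_neq0// mulr1.
by move=> /(congr1 ( *%R ^~ d%:C)); rewrite -mulrA -rmorphM mulVf ?index_neq0// mulr1 mul1r.
Qed.

Lemma index_gt0 : 0 < d.
Proof.
rewrite lt_neqAle eq_sym index_neq0 -invr_ge0 -ler0c /=.
apply: (ce_sqr_ge0 cE1 (x := e)).
by rewrite (bc_jones_star sN cE qs) (bc_jones_idem cE) /= ce_jones bc_incl_scalar.
Qed.

End DualExpectation.

(** * Intermediate subalgebras *)

Section IntermediateExpectation.
Context {R : realType} {A : cstarAlgType R} (B C : set A) (EB EC : A -> A).
Context (sB : star_subalgebra B) (sC : star_subalgebra C) (BC : B `<=` C).
Context (tB : trivial_center B) (tC : trivial_center C).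
Context (tA : trivial_center [set: A]).
Context (minB : minimal_expectation B EB) (minC : minimal_expectation C EC).
Context (s : seq A) (qs : quasi_basis EB s) (dB : R).
Context (dBE : index_map s 1 = dB%:C%:A) (dB0 : dB != 0).
Context (m : seq A) (qm : quasi_basis EC m) (dC : R).
Context (dCE : index_map m 1 = dC%:C%:A).
Context (M : basic_construction B EB) (eC : M) (eCP : bc_act M eC = EC).
Implicit Types (a b c x y : A) (X : M).

Local Notation i := (bc_incl M).
Local Notation e := (bc_jones M).
Local Notation act := (bc_act M).
Local Notation q := (bc_act M (star eC)).
Local Notation k := (bc_act M (star eC) 1).

Let cB : conditional_expectation B EB. Proof. by case: minB. Qed.
Let cC : conditional_expectation C EC. Proof. by case: minC. Qed.
Let sB' := commutant_star_subalgebra sB.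

Let dBC0 : dB%:C != 0 :> R[i].
Proof. by apply: contra_neq dB0 => /complexI. Qed.

Let tracial x y : commutant B x -> EB (x * y) = EB (y * x).
Proof.
apply: (minimal_tracial sB tB tA minB qs dBE dBC0) => z _.
exact: (ce_faithful sB cB qs M).
Qed.

Lemma intermediate_commutant x : commutant B x -> commutant B (EC x).
Proof. by move=> xc n Nn; rewrite -(ceMr sC cC) ?xc ?(ceMl sC cC)//; exact: BC. Qed.

(* The bimodule map [a e b |-> a x b]. *)
Definition bc_slice x X : A := \sum_(l <- s) act X l * x * star l.

Lemma bc_slice_sum (I : Type) (r : seq I) (F : I -> M) x :
  bc_slice x (\sum_(j <- r) F j) = \sum_(j <- r) bc_slice x (F j).
Proof.
rewrite exchange_big; apply: eq_bigr => l _.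
by rewrite bc_act_suml !mulr_suml.
Qed.

Lemma bc_sliceMl x a X : bc_slice x (i a * X) = a * bc_slice x X.
Proof.
rewrite mulr_sumr; apply: eq_bigr => l _.
by rewrite bc_actM bc_inclP !mulrA.
Qed.

Lemma bc_sliceMr x X b : commutant B x -> bc_slice x (X * i b) = bc_slice x X * b.
Proof.
move=> xc.
transitivity (\sum_(l <- s) \sum_(j <- s) act X j * EB (star j * (b * l)) * x * star l).
  apply: eq_bigr => l _; rewrite bc_actM bc_inclP {1}(qs (b * l)) bc_act_sumr.
  rewrite !mulr_suml; apply: eq_bigr => j _; rewrite bc_actMr//.
  exact: (ce_in cB).
rewrite exchange_big mulr_suml; apply: eq_bigr => j _.
transitivity (\sum_(l <- s) act X j * x * (EB (star j * b * l) * star l)).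
  apply: eq_bigr => l _; rewrite !mulrA -[act X j * x * _]mulrA xc ?mulrA//.
  exact: (ce_in cB).
by rewrite -mulr_sumr -(quasi_basis_star cB qs) mulrA.
Qed.

Lemma bc_slice_jones x a b : commutant B x -> bc_slice x (i a * e * i b) = a * x * b.
Proof.
move=> xc; rewrite bc_sliceMr// bc_sliceMl; congr (_ * _); congr (a * _).
transitivity (\sum_(l <- s) x * (EB (1 * l) * star l)).
  apply: eq_bigr => l _; rewrite bc_jonesP mul1r -xc ?mulrA//.
  exact: (ce_in cB).
by rewrite -mulr_sumr -(quasi_basis_star cB qs) mulr1.
Qed.

Lemma bc_slice1 x : bc_slice x 1 = index_map s x.
Proof. by apply: eq_bigr => l _; rewrite bc_act1. Qed.

Lemma intermediate_jones_comm c : C c -> eC * i c = i c * eC.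
Proof.
move=> Cc; apply: bc_ext => a.
by rewrite !bc_actM !bc_inclP eCP (ceMl sC cC).
Qed.

Lemma intermediate_jones_star_comm c : C c -> star eC * i c = i c * star eC.
Proof.
move=> Cc; rewrite -[c]starK (bc_incl_star cB qs) -!starM.
by rewrite intermediate_jones_comm//; exact: subalg_star.
Qed.

Lemma intermediate_jones_idem : eC * eC = eC.
Proof.
by apply: bc_ext => a; rewrite bc_actM eCP (ce_id cC)//; exact: (ce_in cC).
Qed.

Lemma intermediate_jones_sum1 : \sum_(l <- m) i l * eC * i (star l) = 1.
Proof.
apply: bc_ext => a; rewrite bc_act_suml bc_act1 [RHS]qm; apply: eq_bigr => l _.
by rewrite !bc_actM !bc_inclP eCP.
Qed.

Lemma intermediate_jones_expand :
  star eC = \sum_(l <- s) i (q l) * e * i (star (EC l)).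
Proof.
(* [star eC] is kept apart from [eC] because self-adjointness is still to be proved; only
   idempotence is available. *)
have h : star eC = \sum_(l <- s) i l * e * i (star (EC l)).
  rewrite {1}(bc_expand cB qs eC) star_sum; apply: eq_bigr => l _.
  rewrite !starM -!(bc_incl_star cB qs) starK (bc_jones_star sB cB qs) mulrA.
  by rewrite eCP.
rewrite -{1}intermediate_jones_idem starM {2}h mulr_sumr; apply: eq_bigr => l _.
by rewrite !mulrA (bc_mul_incl_jones cB).
Qed.

(** Slice the identity 1 = sum_m m eC^* m^* at x. The left side gives the index of [EB] times
    [EB x]; on the right, the slice Y of eC^* commutes with C, so minimality of [EC] applies to
    it. *)
Lemma intermediate_index_map x : commutant B x ->
  dB%:C *: EB x = dC%:C *: \sum_(l <- s) EC (q l * x) * star (EC l).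
Proof.
move=> xc; set Y := \sum_(l <- s) q l * x * star (EC l).
have YE : bc_slice x (star eC) = Y.
  rewrite intermediate_jones_expand bc_slice_sum; apply: eq_bigr => l _.
  by rewrite bc_slice_jones// intermediate_jones_expand.
have Yc : commutant C Y.
  move=> c Cc; rewrite -YE -bc_sliceMr// -bc_sliceMl.
  by rewrite intermediate_jones_star_comm.
have h : index_map m Y = dC%:C *: EC Y.
  by rewrite (minimal_index_map sC tC tA minC qm Yc) dCE mulr_algl.
have -> : \sum_(l <- s) EC (q l * x) * star (EC l) = EC Y.
  rewrite (ce_sum cC); apply: eq_bigr => l _.
  by rewrite [RHS](ceMr sC cC)//; apply: (subalg_star sC); exact: (ce_in cC).
rewrite -h -mulr_algl -dBE -(minimal_index_map sB tB tA minB qs xc) -bc_slice1.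
have -> : 1 = \sum_(l <- m) i l * star eC * i (star l).
  rewrite -(star1 (A := M)) -intermediate_jones_sum1 star_sum; apply: eq_bigr => l _.
  by rewrite !starM -!(bc_incl_star cB qs) starK mulrA.
rewrite bc_slice_sum; apply: eq_bigr => l _.
by rewrite bc_sliceMr// bc_sliceMl YE.
Qed.

Let adjE a b : EB (star (EC a) * b) = EB (star a * q b).
Proof. by have := bc_act_star eC a b; rewrite eCP. Qed.

Let qC c : C c -> q c = c * k.
Proof.
move=> Cc; transitivity (act (i c * star eC) 1); last by rewrite bc_actM bc_inclP.
by rewrite -intermediate_jones_star_comm// bc_actM bc_inclP mulr1.
Qed.

Let kc : commutant B k.
Proof.
by move=> n Nn; rewrite -bc_actMr// mul1r qC//; exact: BC.
Qed.

(* [k] is the density of [EB \o EC] with respect to the trace [EB]. *)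
Let FE y : EB (EC y) = EB (y * k).
Proof.
have := adjE (star y) 1.
by rewrite mulr1 starK (ce_star cC) starK.
Qed.

Let qMr y h : C h -> commutant B h -> q (y * h) = q y * h.
Proof.
move=> Ch hc; apply/eqP; rewrite -subr_eq0; apply/eqP.
apply: (ce_nondeg_r qs) => b; rewrite -[b]starK.
have e1 u v : EB (u * (v * h)) = EB (star (star u * star h) * v).
  by rewrite starM !starK -mulrA (tracial _ hc) mulrA.
rewrite mulrBr (ceB cB) -adjE !e1 !starK -(ceMr sC cC); last exact: (subalg_star sC).
by rewrite adjE subrr.
Qed.

Let hc : commutant B (EC k) := intermediate_commutant kc.

Let q_cutdown y : q y * EC k = EC (q y) * k.
Proof.
rewrite -qMr//; last exact: (ce_in cC).
rewrite -qC; last exact: (ce_in cC).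
apply/eqP; rewrite -subr_eq0; apply/eqP.
apply: (ce_nondeg_r qs) => b; rewrite -[b]starK; set a := star b.
rewrite mulrBr (ceB cB) -!adjE; apply/eqP; rewrite subr_eq0; apply/eqP.
have Ca := ce_in cC a; set c := EC a in Ca *.
rewrite -(ceMl sC cC (q y)); last exact: (subalg_star sC).
have e1 u : EB (star c * u * k) = EB (star (c * star k) * u).
  by rewrite starM starK -[LHS](tracial _ kc) mulrA.
rewrite FE e1 -adjE (ceMl sC cC)// starM -(ce_star cC) starK.
by rewrite -mulrA (tracial _ hc) mulrA.
Qed.

Let k_star : star k = k.
Proof.
apply/eqP; rewrite -subr_eq0; apply/eqP; apply: (ce_nondeg_r qs) => y.
have h : EB (y * star k) = EB (EC y).
  rewrite -(tracial _ (subalg_star sB' kc)) -{1}[y]starK -starM (ce_star cB).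
  by rewrite -FE (ce_star cC) (ce_star cB) starK.
by rewrite mulrBr (ceB cB) h FE subrr.
Qed.

(** Tested against the commutant of B, both sides reduce through [intermediate_index_map] to the
    same sum; [q_cutdown] is what matches the terms. *)
Let k_sqr : EC k = k * k.
Proof.
have key x : commutant B x -> EB (EC k * x) = EB (k * k * x).
  move=> xc; have kxc := subalgM sB' kc xc.
  rewrite -mulrA (tracial (k * x) kc) -FE.
  apply: (scalerI dBC0); rewrite !intermediate_index_map//.
  - congr (_ *: _); apply: eq_bigr => l _; congr (_ * _).
    rewrite (ceMr sC cC (q l) (ce_in cC (k * x))) mulrA q_cutdown -mulrA.
    exact: (ceMl sC cC (k * x) (ce_in cC (q l))).
  - exact: intermediate_commutant.
  - exact: (subalgM sB').
have wc : commutant B (star (EC k - k * k)).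
  by apply: (subalg_star sB'); apply: (subalgB sB') => //; exact: (subalgM sB').
have : EB (star (star (EC k - k * k)) * star (EC k - k * k)) = 0.
  by rewrite starK mulrBl (ceB cB) key// subrr.
move=> /(ce_faithful sB cB qs M) /(congr1 star); rewrite starK star0 => /eqP.
by rewrite subr_eq0 => /eqP.
Qed.

(* Positivity of [EB] at [k - 1] gives [1 <= EB (k^2)], and positivity of
   [EB \o EC] at the same element gives [EB (k^2) <= 1]. *)
Let k_eq1 : k = 1.
Proof.
have EBk : EB k = 1 by rewrite -[k]mul1r -FE (ce1 sC cC) (ce1 sB cB).
have [t tE] := ce_commutant_scalar sB cB tB (subalgM sB' kc kc).
set w := k - 1.
have sw : star w = w by rewrite starB star1 k_star.
have ww : w * w = k * k - (k + k) + 1 by rewrite /w; ncring.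
have EBww : EB (star w * w) = (t - 1)%:A.
  rewrite sw ww (ceD cB) (ceB cB) (ceD cB) tE EBk (ce1 sB cB).
  by rewrite scalerBl scale1r; ncring.
have FEww : EB (EC (star w * w)) = (1 - t)%:A.
  rewrite sw ww (ceD cC) (ceB cC) (ceD cC) -k_sqr (ce1 sC cC).
  rewrite (ce_id cC (ce_in cC k)) (ceD cB) (ceB cB) (ceD cB) (ce1 sB cB) k_sqr tE.
  by rewrite scalerBl scale1r; ncring.
have t1 : 0 <= t - 1 by exact: (ce_sqr_ge0 cB EBww).
have t2 : 0 <= 1 - t.
  apply: (@scalar_positive R A); rewrite -FEww.
  case: cB => _ _ _ _; apply; case: cC => _ _ _ _; apply.
  by exists w.
have te : t - 1 = 0.
  by apply/eqP; rewrite eq_le t1 andbT -oppr_ge0 opprB.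
move: EBww; rewrite te scale0r => /(ce_faithful sB cB qs M) /eqP.
by rewrite subr_eq0 => /eqP.
Qed.

Lemma intermediate_ce_comp x : EB (EC x) = EB x.
Proof. by rewrite FE k_eq1 mulr1. Qed.

Lemma intermediate_jones_star : star eC = eC.
Proof.
apply: bc_ext => u; rewrite [RHS](congr1 (fun F => F u) eCP); move: u.
apply: (bc_act_starP cB qs) => a b; rewrite eCP -(ce_star cC).
transitivity (EB (EC (star a) * EC b)).
  by rewrite -(ceMl sC cC b (ce_in cC _)) intermediate_ce_comp.
by rewrite -(ceMr sC cC (star a) (ce_in cC b)) intermediate_ce_comp.
Qed.

(** The elements [EC l] form a quasi-basis of [EB] restricted to C, so this is the multiplicativity
    [A:B] = [A:C][C:B]. *)
Lemma intermediate_index :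
  dB%:C%:A = dC%:C *: \sum_(l <- s) EC l * star (EC l).
Proof.
have c1 := subalg1 sB'; have := intermediate_index_map c1.
rewrite (ce1 sB cB) => ->; congr (_ *: _); apply: eq_bigr => l _.
by rewrite mulr1 intermediate_jones_star eCP (ce_id cC)//; exact: (ce_in cC).
Qed.

End IntermediateExpectation.

(** * Unital *-morphisms are contractive *)

Section StarMorphism.
Context {R : realType} {A A' : cstarAlgType R} (phi : A -> A').
Context (phiD : forall x y, phi (x + y) = phi x + phi y).
Context (phiZ : forall (c : R[i]) x, phi (c *: x) = c *: phi x).
Context (phiM : forall x y, phi (x * y) = phi x * phi y).
Context (phi1 : phi 1 = 1) (phi_star : forall x, phi (star x) = star (phi x)).

(* For [x] self-adjoint of norm at most [1], [x + i sqrt(1 - x^2)] is unitary,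
   and so is its image. *)
Lemma star_morphism_contractive x : cnorm (phi x) <= cnorm x.
Proof.
have phiB u v : phi (u - v) = phi u - phi v.
  by rewrite phiD -scaleN1r phiZ scaleN1r.
have unit_ball u : star u = u -> cnorm u <= 1 -> cnorm (phi u) <= 1.
  move=> su u1; have suu : star (u * u) = u * u by rewrite starM su.
  have uu1 : cnorm (u * u) <= 1.
    by rewrite cnorm_sqr_selfadjoint// expr_le1 ?cnorm_ge0.
  have [y [sy _ yE yc _]] := sqrt_exists suu uu1.
  have uy : u * y = y * u by apply: yc; rewrite mulrA.
  have [w wE] : exists w, 1 - y = w by exists (1 - y).
  have sw : star w = w by rewrite -wE starB star1 sy.
  have uw : u * w = w * u by rewrite -wE mulrBr mulrBl uy mulr1 mul1r.
  rewrite wE in yE.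
  have h : phi u * phi u + phi w * phi w = 1.
    by rewrite -!phiM -phiD yE addrC subrK phi1.
  have su' : star (phi u) = phi u by rewrite -phi_star su.
  have [v vE] : exists v : A', 'i *: phi w = v by exists ('i *: phi w).
  have sv : star v = - v by rewrite -vE star_scale_i -phi_star sw.
  have vv : v * v = - (phi w * phi w) by rewrite -vE scale_iM.
  have vu : v * phi u = phi u * v.
    by rewrite -vE -scalerAl -scalerAr -!phiM uw.
  have unitary : star (phi u + v) * (phi u + v) = 1.
    rewrite starD su' sv -h.
    have -> : (phi u - v) * (phi u + v) =
      phi u * phi u + (phi u * v - v * phi u) - v * v by ncring.
    by rewrite vu subrr addr0 vv opprK.
  have n1 : cnorm (phi u + v) = 1.
    have := cstar_identity (phi u + v); rewrite unitary cnorm1 => /esym/eqP.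
    by rewrite sqrp_eq1 ?cnorm_ge0// => /eqP.
  have n2 : cnorm (phi u - v) = 1 by rewrite -n1 -cnorm_star starB su' sv opprK.
  have := cnorm_double (phi u).
  have -> : phi u + phi u = (phi u + v) + (phi u - v) by ncring.
  by have := cnormD (phi u + v) (phi u - v); rewrite n1 n2; lra.
have sa u : star u = u -> cnorm (phi u) <= cnorm u.
  move=> su; have [->|u0] := eqVneq u 0.
    by rewrite (_ : phi 0 = 0) ?cnorm0//; have := phiB 0 0; rewrite !subrr.
  have nu := cnorm_neq0 u0.
  have nV : `|(cnorm u)^-1| = (cnorm u)^-1 by rewrite ger0_norm ?invr_ge0 ?cnorm_ge0.
  have : cnorm (phi ((cnorm u)^-1%:C *: u)) <= 1.
    apply: unit_ball; first by rewrite starZr su.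
    by rewrite cnormZr nV mulVf ?lt0r_neq0.
  by rewrite phiZ cnormZr nV mulrC ler_pdivrMr// mul1r.
rewrite -(@ler_pXn2r _ 2) ?nnegrE ?cnorm_ge0// -!cstar_identity -phi_star -phiM.
by apply: sa; rewrite starM starK.
Qed.

End StarMorphism.

(** * Functional calculus of a multiple of a projection *)

Section ProjectionCalculus.
Context {R : realType} {A : cstarAlgType R} (p : A).
Context (pp : p * p = p) (sp : star p = p).
Implicit Types (c t u : R).

Let qq : (1 - p) * (1 - p) = 1 - p.
Proof.
have -> : (1 - p) * (1 - p) = 1 - p - (p - p * p) by ncring.
by rewrite pp subrr subr0.
Qed.

Let pq : p * (1 - p) = 0. Proof. by rewrite mulrBr mulr1 pp subrr. Qed.
Let qp : (1 - p) * p = 0. Proof. by rewrite mulrBl mul1r pp subrr. Qed.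

Definition two_values u t : A := u%:C *: (1 - p) + t%:C *: p.

Lemma two_valuesM u t u' t' :
  two_values u t * two_values u' t' = two_values (u * u') (t * t').
Proof.
rewrite /two_values mulrDl !mulrDr -!(scalerAl, scalerAr).
by rewrite pp qq pq qp !scaler0 addr0 add0r !scalerA !rmorphM.
Qed.

Lemma two_values_eq u : two_values u u = u%:C%:A.
Proof. by rewrite /two_values -scalerDr subrK. Qed.

Lemma two_valuesB u t u' t' :
  two_values u t - two_values u' t' = two_values (u - u') (t - t').
Proof. by rewrite /two_values !rmorphB !scalerBl; ncring. Qed.

Lemma two_valuesX u t n : two_values u t ^+ n = two_values (u ^+ n) (t ^+ n).
Proof.
elim: n => [|n IH]; last by rewrite !exprS IH two_valuesM.
by rewrite !expr0 two_values_eq rmorph1 scale1r.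
Qed.

Lemma poly_eval_two_values (f : {poly R}) u t :
  poly_eval f (two_values u t) = two_values f.[u] f.[t].
Proof.
rewrite /poly_eval !horner_coef /two_values !rmorph_sum !scaler_suml -big_split.
apply: eq_bigr => j _.
by rewrite two_valuesX /two_values scalerDr !scalerA !rmorphM.
Qed.

Lemma real_spectrum_two_values u t v :
  real_spectrum (two_values u t) v -> v = u \/ v = t.
Proof.
move=> h; apply: contrapT => /not_orP[vu vt]; apply: h.
exists (two_values (u - v)^-1 (t - v)^-1).
rewrite -two_values_eq two_valuesB !two_valuesM.
have uv : u - v != 0 by rewrite subr_eq0 eq_sym; apply/eqP.
have tv : t - v != 0 by rewrite subr_eq0 eq_sym; apply/eqP.
by rewrite !divff// !mulVf// two_values_eq rmorph1 scale1r.
Qed.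

Lemma real_spectrum_two_values_l u t : p != 1 -> real_spectrum (two_values u t) u.
Proof.
move=> p1 [b [+ _]]; rewrite -two_values_eq two_valuesB subrr.
move=> /(congr1 (fun x => (1 - p) * x)); rewrite mulr1 mulrA /two_values.
rewrite scale0r add0r -scalerAr qp scaler0 mul0r => /esym/eqP.
by rewrite subr_eq0 eq_sym (negbTE p1).
Qed.

Lemma real_spectrum_two_values_r u t : p != 0 -> real_spectrum (two_values u t) t.
Proof.
move=> p0 [b [+ _]]; rewrite -two_values_eq two_valuesB subrr.
move=> /(congr1 (fun x => p * x)); rewrite mulr1 mulrA /two_values.
by rewrite scale0r addr0 -scalerAr pq scaler0 mul0r => /esym/eqP; rewrite (negbTE p0).
Qed.

(* A convex combination of the unitaries [1] and [2 p - 1], up to a factor. *)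
Lemma cnorm_two_values u t (r : R) : `|u| <= r -> `|t| <= r ->
  cnorm (two_values u t) <= r.
Proof.
move=> ur tr.
have -> : two_values u t =
    ((u + t) / 2)%:C%:A + ((t - u) / 2)%:C *: two_values (-1) 1.
  rewrite -two_values_eq /two_values [X in _ = _ + X]scalerDr !scalerA -!rmorphM addrACA.
  rewrite -!scalerDl -!rmorphD.
  by congr ((real_complex _ _) *: _ + (real_complex _ _) *: _); field.
have n1 : cnorm (two_values (-1) 1) = 1.
  have s1 : star (two_values (-1) 1) = two_values (-1) 1.
    by rewrite /two_values starD !starZr starB star1 sp.
  have := cstar_identity (two_values (-1) 1).
  rewrite s1 two_valuesM mulrNN !mulr1 two_values_eq rmorph1 scale1r cnorm1.
  by move=> /esym/eqP; rewrite sqrp_eq1 ?cnorm_ge0// => /eqP.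
apply: le_trans (cnormD _ _) _; rewrite cnorm_scalar cnormZr n1 mulr1.
move: ur tr; rewrite !ler_norml => /andP[u1 u2] /andP[t1 t2].
have [h1|h1] := lerP 0 ((u + t) / 2); have [h2|h2] := lerP 0 ((t - u) / 2);
  rewrite ?(ger0_norm h1) ?(ger0_norm h2) ?(ltr0_norm h1) ?(ltr0_norm h2); lra.
Qed.

Lemma is_fun_calc_two_values (f : R -> R) u t :
  is_fun_calc f (two_values u t) (two_values (f u) (f t)).
Proof.
move=> g r h; rewrite poly_eval_two_values two_valuesB.
(* If p is 0 or 1, only one of the two values is in the spectrum; the hypothesis then bounds only
   that one, which is the whole element. *)
have [p0|p0] := eqVneq p 0; have [p1|p1] := eqVneq p 1.
- by move: (oner_neq0 A); rewrite -p1 p0 eqxx.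
- have hu := h _ (real_spectrum_two_values_l (u := u) (t := t) p1).
  rewrite /two_values p0 scaler0 subr0 addr0 cnorm_scalar; exact: hu.
- have ht := h _ (real_spectrum_two_values_r (u := u) (t := t) p0).
  rewrite /two_values p1 subrr scaler0 add0r cnorm_scalar; exact: ht.
- by apply: cnorm_two_values; apply: h;
    [exact: real_spectrum_two_values_l|exact: real_spectrum_two_values_r].
Qed.

Lemma fun_calc_projection (f : R -> R) t : t != 0 -> f 0 = 0 ->
  fun_calc f (t%:C *: p) = (f t)%:C *: p.
Proof.
move=> t0 f0; have tE c : two_values 0 c = c%:C *: p.
  by rewrite /two_values scale0r add0r.
rewrite -!tE; have h : is_fun_calc f (two_values 0 t) (two_values 0 (f t)).
  by rewrite -{2}f0; exact: is_fun_calc_two_values.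
rewrite /fun_calc; case: xgetP => [y _ hy|/(_ _ h)//].
(* Uniqueness: the polynomial (f(t)/t) X agrees with f at 0 and at t, so it approximates f with
   error 0 on the spectrum and determines y. *)
have spec v : real_spectrum (two_values 0 t) v ->
    `|((f t / t) *: 'X).[v] - f v| <= 0.
  move=> /real_spectrum_two_values[] ->; rewrite hornerZ hornerX.
    by rewrite mulr0 f0 subrr normr0.
  by rewrite divfK// subrr normr0.
have := hy _ _ spec; rewrite poly_eval_two_values !hornerZ !hornerX mulr0 divfK//.
move=> n0; apply/eqP; rewrite eq_sym -subr_eq0; apply/eqP/cnorm_eq0/eqP.
by rewrite eq_le n0 cnorm_ge0.
Qed.

End ProjectionCalculus.

(** * The Fourier transform *)

Section FourierTower.
Context {R : realType} {A : cstarAlgType R} (B : set A) (EB : A -> A).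
Context (sB : star_subalgebra B) (cB : conditional_expectation B EB).
Context (s : seq A) (qs : quasi_basis EB s) (dB : R).
Context (A1 : basic_construction B EB) (E1 : A1 -> A).
Local Notation i1 := (bc_incl A1).
Local Notation e1 := (bc_jones A1).
Context (cE1 : conditional_expectation (range i1) (i1 \o E1)).
Context (E1e : E1 e1 = dB^-1%:C%:A).
Context (v : seq A1) (qv : quasi_basis (i1 \o E1) v).
Context (A2 : basic_construction (range i1) (i1 \o E1)).
Local Notation i2 := (bc_incl A2).
Local Notation e2 := (bc_jones A2).
Implicit Types (a b : A) (X Y Z : A1).

Lemma bc_generators_ind (P : A1 -> Prop) : P 0 ->
  (forall X Y, P X -> P Y -> P (X + Y)) ->
  (forall a b, P (i1 a * e1 * i1 b)) -> forall X, P X.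
Proof.
by move=> P0 PD Pg X; rewrite (bc_expand cB qs X); elim/big_ind: _.
Qed.

(* Up to the factor [delta], the Fourier transform of [X]; as an operator on
   [A1] it maps [a e1 b] to [a X b] divided by the index. *)
Definition rotation X : A2 :=
  \sum_(l <- s) i2 (i1 l * X) * e2 * i2 (e1 * i1 (star l)).

Lemma rotation_act X a b : commutant (i1 @` B) X ->
  bc_act A2 (rotation X) (i1 a * e1 * i1 b) = dB^-1%:C *: (i1 a * X * i1 b).
Proof.
move=> Xc; rewrite bc_act_suml.
transitivity (\sum_(l <- s) dB^-1%:C *: (i1 (l * EB (star l * a)) * X * i1 b)).
  apply: eq_bigr => l _; rewrite !bc_actM !bc_inclP bc_jonesP /=.
  have -> : e1 * i1 (star l) * (i1 a * e1 * i1 b) = i1 (EB (star l * a)) * e1 * i1 b.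
    by rewrite -(bc_jones_cutdown sB cB) bc_inclM !mulrA.
  rewrite (bc_ceMr cB qs cE1) (bc_ceMl cB qs cE1) E1e.
  rewrite mulr_algr -scalerAl bc_inclZ -scalerAr !bc_inclM; congr (_ *: _).
  rewrite -!mulrA; congr (_ * _); rewrite !mulrA; congr (_ * _).
  by apply: Xc; exists (EB (star l * a)) => //; exact: (ce_in cB).
by rewrite -scaler_sumr -!mulr_suml -bc_incl_sum -qs.
Qed.

(** Turns commutation with an operator on [A1] into an identity inside [A1], which is easy to verify
    for the generators of [C1]. *)
Lemma rotation_comm X Y : commutant (i1 @` B) X ->
  (forall a, Y * i1 a * X = i1 (bc_act A1 Y a) * X) ->
  i2 Y * rotation X = rotation X * i2 Y.
Proof.
move=> xc h; apply: bc_ext; apply: bc_generators_ind.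
- by rewrite !bc_act0r.
- by move=> U V hU hV; rewrite !bc_actDr hU hV.
- move=> a b; rewrite !bc_actM !bc_inclP rotation_act// -scalerAr.
  rewrite !mulrA (bc_mul_incl_jones cB) rotation_act//.
  by rewrite h.
Qed.

(** On vectors a e1 b the two inner products differ by replacing X^*(a^* a') with the adjoint of
    X^*(a'^* a). The hypothesis holds for composites of conditional expectations, which preserve
    adjoints. *)
Lemma rotation_star X : commutant (i1 @` B) X ->
  (forall a, bc_act A1 (star X) (star a) = star (bc_act A1 (star X) a)) ->
  star (rotation X) = rotation X.
Proof.
move=> Xc hX; apply: bc_ext; apply: (bc_act_starP cE1 qv) => Y Z; move: Y.
apply: bc_generators_ind.
- by rewrite bc_act0r star0 !mul0r.
- by move=> U V hU hV; rewrite bc_actDr !starD !mulrDl !(ceD cE1) hU hV.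
move=> a b; move: Z; apply: bc_generators_ind.
- by rewrite bc_act0r !mulr0.
- by move=> U V hU hV; rewrite bc_actDr !mulrDr !(ceD cE1) hU hV.
move=> a' b'; rewrite !rotation_act//= starZr -scalerAl -scalerAr.
congr i1; rewrite !(bc_ceZ cE1); congr (_ *: _).
rewrite !starM -!(bc_incl_star cB qs) (bc_jones_star sB cB qs).
rewrite -!mulrA !(bc_ceMl cB qs cE1); congr (_ * _).
rewrite !mulrA !(bc_ceMr cB qs cE1); congr (_ * _).
rewrite -[star X * _ * _]mulrA -[e1 * _ * _]mulrA -bc_inclM.
rewrite (bc_ce_mul_jones cB qs cE1) -[X in _ = E1 X]starK (bc_ce_star cB qs cE1).
rewrite !starM -(bc_incl_star cB qs) (bc_jones_star sB cB qs) mulrA.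
rewrite (bc_ce_mul_jones cB qs cE1) hX starM starK.
by rewrite E1e starZr star1 mulr_algl mulr_algr.
Qed.

Lemma fourierE X : fourier A2 dB s X =
  (Num.sqrt dB ^+ 3)%:C *: (dB^-1%:C *: rotation X).
Proof.
rewrite /fourier; congr (_ *: (_ *: _)); apply: eq_bigr => l _.
by rewrite !bc_inclM !mulrA.
Qed.

End FourierTower.

(** * The algebra [C1] and the image of the Jones projection in it *)

Section IntermediateTower.
Context {R : realType} {A : cstarAlgType R} (B C : set A) (EB EC : A -> A).
Context (sB : star_subalgebra B) (sC : star_subalgebra C) (BC : B `<=` C).
Context (tB : trivial_center B) (tC : trivial_center C).
Context (tA : trivial_center [set: A]).
Context (minB : minimal_expectation B EB) (minC : minimal_expectation C EC).
Context (s : seq A) (qs : quasi_basis EB s) (dB : R).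
Context (dBE : index_map s 1 = dB%:C%:A).
Context (m : seq A) (qm : quasi_basis EC m) (dC : R).
Context (dCE : index_map m 1 = dC%:C%:A).
Context (A1 : basic_construction B EB) (E1 : A1 -> A).
Local Notation i1 := (bc_incl A1).
Local Notation e1 := (bc_jones A1).
Context (minE1 : minimal_expectation (range i1) (i1 \o E1)).
Context (v : seq A1) (qv : quasi_basis (i1 \o E1) v).
Context (A2 : basic_construction (range i1) (i1 \o E1)).
Local Notation i2 := (bc_incl A2).
Context (eC : A1) (eCP : bc_act A1 eC = EC).

Let cB : conditional_expectation B EB. Proof. by case: minB. Qed.
Let cC : conditional_expectation C EC. Proof. by case: minC. Qed.
Let cE1 : conditional_expectation (range i1) (i1 \o E1). Proof. by case: minE1. Qed.
Let dB0 : dB != 0 := index_neq0 sB tB tA minB qs dBE minE1.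
Let E1e : E1 e1 = dB^-1%:C%:A := ce_jones sB tB tA minB qs dBE minE1.
Let eC_star : star eC = eC.
Proof. exact: (intermediate_jones_star sB sC BC tB tC tA minB minC qs dBE dB0 qm dCE). Qed.
Let comp x : EB (EC x) = EB x.
Proof. exact: (intermediate_ce_comp sB sC BC tB tC tA minB minC qs dBE dB0 qm dCE eCP). Qed.
Let index : dB%:C%:A = dC%:C *: \sum_(l <- s) EC l * star (EC l).
Proof. exact: (intermediate_index sB sC BC tB tC tA minB minC qs dBE dB0 qm dCE eCP). Qed.

Lemma intermediate_jones_commutant : commutant (i1 @` B) eC.
Proof.
move=> _ [b Bb <-]; apply: (intermediate_jones_comm sC minC eCP).
exact: BC.
Qed.

Lemma intermediate_index_neq0 : dC != 0.
Proof.
apply/eqP => d0; move: index; rewrite d0 scale0r => /eqP.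
rewrite scaler_eq0 oner_eq0 orbF => /eqP /complexI /eqP.
by rewrite (negbTE dB0).
Qed.

Lemma intermediate_index_sum :
  \sum_(l <- s) EC l * star (EC l) = (dB / dC)%:C%:A.
Proof.
have d0 := intermediate_index_neq0.
by rewrite -[LHS](scaleCVK _ d0) -index scalerA mulrC rmorphM.
Qed.

Lemma intermediate_jones_sum :
  eC = \sum_(l <- s) i1 (EC l) * e1 * i1 (star (EC l)).
Proof.
rewrite -{1}eC_star (intermediate_jones_expand sB minB minC qs eCP).
by apply: eq_bigr => l _; rewrite eC_star eCP.
Qed.

Lemma ce_intermediate_jones : E1 eC = dC^-1%:C%:A.
Proof.
rewrite intermediate_jones_sum (bc_ce_sum cE1).
transitivity (dB^-1%:C *: \sum_(l <- s) EC l * star (EC l)).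
  rewrite scaler_sumr; apply: eq_bigr => l _.
  rewrite (bc_ceMr cB qs cE1) (bc_ceMl cB qs cE1) E1e.
  by rewrite mulr_algr scalerAl.
rewrite intermediate_index_sum scalerA -rmorphM mulrA mulVf// mul1r.
by [].
Qed.

Lemma intermediate_index_gt0 : 0 < dC.
Proof.
rewrite lt_neqAle eq_sym intermediate_index_neq0 -invr_ge0 -ler0c /=.
apply: (ce_sqr_ge0 cE1 (x := eC)).
rewrite eC_star (intermediate_jones_idem minC eCP) /= ce_intermediate_jones.
exact: bc_incl_scalar.
Qed.

Lemma intermediate_jones_cutdown a : eC * i1 a * eC = i1 (EC a) * eC.
Proof.
apply: bc_ext => u; rewrite !bc_actM !bc_inclP eCP (ceMr sC cC)//.
exact: (ce_in cC).
Qed.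

Local Notation C1 := (intermediate_basic_construction eC).

Lemma intermediate_basic_construction_star_subalgebra : star_subalgebra C1.
Proof.
split.
- by move=> N [N1 _ _ _ _] _.
- by move=> c x y xc yc N cN sN; case: (cN) => _ h _ _ _; apply: h; [exact: xc|exact: yc].
- by move=> x y xc yc N cN sN; case: (cN) => _ _ h _ _; apply: h; [exact: xc|exact: yc].
- by move=> x xc N cN sN; case: (cN) => _ _ _ h _; apply: h; exact: xc.
Qed.

Lemma intermediate_basic_construction_jones : C1 eC.
Proof. by move=> N _; apply; right. Qed.

Lemma intermediate_basic_construction_incl a : C1 (i1 a).
Proof. by move=> N _; apply; left; exists a. Qed.

(* Elements of [C1] commute with the multiple [rotation eC] of the Jones
   projection of [A1] onto [C1]; this property passes to norm limits. *)
Lemma intermediate_basic_construction_rotation X : C1 X ->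
  i2 X * rotation s A2 eC = rotation s A2 eC * i2 X.
Proof.
move=> XC; have eCc := intermediate_jones_commutant.
set W := rotation s A2 eC.
have sW : star W = W.
  apply: (rotation_star sB cB qs cE1 E1e qv) => // a.
  by rewrite eC_star eCP (ce_star cC).
apply: (XC [set Y | i2 Y * W = W * i2 Y]); first split => /=.
- by rewrite bc_incl1 mul1r mulr1.
- move=> c x y xc yc; rewrite bc_inclD bc_inclZ mulrDl mulrDr.
  by rewrite -scalerAl -scalerAr xc yc.
- by move=> x y xc yc; rewrite bc_inclM -mulrA yc mulrA xc mulrA.
- move=> x xc; rewrite (bc_incl_star cE1 qv) -sW -!starM.
  by rewrite xc.
- move=> u l h ul; apply/eqP; rewrite -subr_eq0; apply/eqP.
  have i2B x y : i2 (x - y) = i2 x - i2 y by exact: bc_inclB.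
  apply: (norm_closed_eq (F := fun x => i2 x * W - W * i2 x)
    (K := cnorm W + cnorm W)) ul => /= [x y|n]; last by rewrite h subrr.
  have -> : i2 x * W - W * i2 x - (i2 y * W - W * i2 y) =
      (i2 x - i2 y) * W - W * (i2 x - i2 y) by ncring.
  rewrite -i2B; have hxy : cnorm (i2 (x - y)) <= cnorm (x - y).
    apply: star_morphism_contractive.
    - exact: bc_inclD.
    - exact: bc_inclZ.
    - exact: bc_inclM.
    - exact: bc_incl1.
    - exact: (bc_incl_star cE1 qv).
  have := cnormB (i2 (x - y) * W) (W * i2 (x - y)).
  have := cnormM (i2 (x - y)) W; have := cnormM W (i2 (x - y)).
  by have := ler_wpM2l (cnorm_ge0 W) hxy; lra.
- move=> _ [[a _ <-]|->] /=.
    apply: (rotation_comm sB cB qs cE1 E1e A2 eCc) => b.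
    by rewrite bc_inclP bc_inclM.
  apply: (rotation_comm sB cB qs cE1 E1e A2 eCc) => b.
  by rewrite intermediate_jones_cutdown eCP.
Qed.

(** Evaluate the commutation with [rotation eC] at the vector e1: one order gives X eC, the other
    the image of X e1 = i1(X 1) e1, both divided by the index. *)
Lemma intermediate_basic_construction_cutdown X : C1 X ->
  X * eC = i1 (bc_act A1 X 1) * eC.
Proof.
move=> /intermediate_basic_construction_rotation /(congr1 (fun T => bc_act A2 T e1)).
have act1 := rotation_act sB cB qs cE1 E1e A2 _ 1 intermediate_jones_commutant.
have h a : bc_act A2 (rotation s A2 eC) (i1 a * e1) = dB^-1%:C *: (i1 a * eC).
  by rewrite -[i1 a * e1]mulr1 -(bc_incl1 A1) act1 bc_incl1 !mulr1.
rewrite !bc_actM !bc_inclP (bc_mul_jones cB X) h -[e1]mul1r -(bc_incl1 A1) h.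
rewrite bc_incl1 mul1r -scalerAr => /(congr1 (fun x => dB%:C *: x)).
by rewrite !scaleCKV.
Qed.

(** Since e1 = e1 eC, the image of e1 ends in eC and so has the form z eC with z in A. Applying [E1]
    gives z / [A:C] = 1 / [A:B]. *)
Lemma intermediate_ce_jones (EC1 : A1 -> A1) :
  conditional_expectation C1 EC1 -> (forall X, E1 (EC1 X) = E1 X) ->
  EC1 e1 = (dC / dB)%:C *: eC.
Proof.
move=> cC1 h; have sC1 := intermediate_basic_construction_star_subalgebra.
have C1e := intermediate_basic_construction_jones.
have e1eC : e1 * eC = e1.
  by apply: bc_ext => u; rewrite bc_actM eCP !bc_jonesP comp.
have ZE : EC1 e1 = i1 (bc_act A1 (EC1 e1) 1) * eC.
  rewrite -(intermediate_basic_construction_cutdown (ce_in cC1 e1)).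
  by rewrite -(ceMr sC1 cC1 e1 C1e) e1eC.
have d0 := intermediate_index_neq0.
move: ZE (h e1); set z := bc_act A1 (EC1 e1) 1 => ZE.
rewrite ZE (bc_ceMl cB qs cE1) ce_intermediate_jones E1e mulr_algr.
move=> /(congr1 (fun x => dC%:C *: x)); rewrite scaleCKV// scalerA -rmorphM => zE.
by rewrite zE bc_incl_scalar mulr_algl.
Qed.

End IntermediateTower.

(** * The angle operator of a co-commuting square *)

Section CocommutingRotation.
Context {R : realType} {A : cstarAlgType R} (B C D : set A) (EB EC ED : A -> A).
Context (sB : star_subalgebra B) (sC : star_subalgebra C) (sD : star_subalgebra D).
Context (BC : B `<=` C) (BD : B `<=` D).
Context (tB : trivial_center B) (tC : trivial_center C) (tD : trivial_center D).
Context (tA : trivial_center [set: A]).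
Context (minB : minimal_expectation B EB) (minC : minimal_expectation C EC).
Context (minD : minimal_expectation D ED).
Context (s : seq A) (qs : quasi_basis EB s) (dB : R).
Context (dBE : index_map s 1 = dB%:C%:A).
Context (mC : seq A) (qmC : quasi_basis EC mC) (dC : R).
Context (dCE : index_map mC 1 = dC%:C%:A).
Context (mD : seq A) (qmD : quasi_basis ED mD) (dD : R).
Context (dDE : index_map mD 1 = dD%:C%:A).
Context (A1 : basic_construction B EB) (E1 : A1 -> A).
Local Notation i1 := (bc_incl A1).
Local Notation e1 := (bc_jones A1).
Context (minE1 : minimal_expectation (range i1) (i1 \o E1)).
Context (v : seq A1) (qv : quasi_basis (i1 \o E1) v).
Context (A2 : basic_construction (range i1) (i1 \o E1)).
Local Notation i2 := (bc_incl A2).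
Context (eC : A1) (eCP : bc_act A1 eC = EC) (eD : A1) (eDP : bc_act A1 eD = ED).
Context (EC1 ED1 : A1 -> A1).
Context (cC1 : conditional_expectation (intermediate_basic_construction eC) EC1).
Context (cD1 : conditional_expectation (intermediate_basic_construction eD) ED1).
Context (cocommuting : commuting_square (i1 \o E1) EC1 ED1).

Let cB : conditional_expectation B EB. Proof. by case: minB. Qed.
Let cC : conditional_expectation C EC. Proof. by case: minC. Qed.
Let cD : conditional_expectation D ED. Proof. by case: minD. Qed.
Let cE1 : conditional_expectation (range i1) (i1 \o E1). Proof. by case: minE1. Qed.
Let dB0 : dB != 0 := index_neq0 sB tB tA minB qs dBE minE1.
Let E1e : E1 e1 = dB^-1%:C%:A := ce_jones sB tB tA minB qs dBE minE1.
Let dC0 : dC != 0.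
Proof. exact: (intermediate_index_neq0 sB sC BC tB tC tA minB minC qs dBE qmC dCE minE1 eCP). Qed.
Let dD0 : dD != 0.
Proof. exact: (intermediate_index_neq0 sB sD BD tB tD tA minB minD qs dBE qmD dDE minE1 eDP). Qed.
Let eC_star : star eC = eC.
Proof. exact: (intermediate_jones_star sB sC BC tB tC tA minB minC qs dBE dB0 qmC dCE). Qed.
Let eD_star : star eD = eD.
Proof. exact: (intermediate_jones_star sB sD BD tB tD tA minB minD qs dBE dB0 qmD dDE). Qed.

(* Apply [EC1] to both sides of [eD = \sum_l ED(l) e1 ED(l)^*]. *)
Lemma cocommuting_sum :
  \sum_(l <- s) i1 (ED l) * eC * i1 (star (ED l)) = (dB / (dC * dD))%:C%:A.
Proof.
have [comp1 comp2] := cocommuting.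
have sC1 : star_subalgebra (intermediate_basic_construction eC).
  exact: intermediate_basic_construction_star_subalgebra.
have C1i a : intermediate_basic_construction eC (i1 a).
  exact: intermediate_basic_construction_incl.
(* Compatibility follows from the square itself: [ED1 \o EC1] is the expectation onto A, and [EC1]
   is idempotent. *)
have E1EC1 X : E1 (EC1 X) = E1 X.
  apply: (@bc_incl_inj _ _ _ _ A1); have := comp2 (EC1 X); rewrite /= => <-.
  by rewrite (ce_id cC1 (ce_in cC1 X)) comp2.
have EC1e : EC1 e1 = (dC / dB)%:C *: eC.
  exact: (intermediate_ce_jones sB sC BC tB tC tA minB minC qs dBE qmC dCE minE1 qv A2 eCP).
have h : EC1 eD = dD^-1%:C%:A.
  rewrite -{1}(ce_id cD1 (intermediate_basic_construction_jones (eC := eD))) comp1 /=.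
  rewrite (ce_intermediate_jones sB sD BD tB tD tA minB minD qs dBE qmD dDE minE1 eDP).
  exact: bc_incl_scalar.
have sumE : eD = \sum_(l <- s) i1 (ED l) * e1 * i1 (star (ED l)).
  exact: (intermediate_jones_sum sB sD BD tB tD tA minB minD qs dBE qmD dDE minE1).
move: h; rewrite sumE (ce_sum cC1) => h.
transitivity ((dB / dC)%:C *: (dD^-1%:C%:A : A1)); last first.
  by rewrite scalerA -rmorphM invfM mulrA.
rewrite -h scaler_sumr; apply: eq_bigr => l _.
rewrite (ceMr sC1 cC1 _ (C1i _)) (ceMl sC1 cC1 _ (C1i _)) EC1e.
rewrite -scalerAr -scalerAl scalerA -rmorphM.
have -> : dB / dC * (dC / dB) = 1 by field; rewrite ?dB0 ?dC0 ?dD0.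
by rewrite scale1r.
Qed.

Let angle_commutant : commutant (i1 @` B) (eC * eD).
Proof.
move=> x Bx.
have xC := intermediate_jones_commutant sC BC minC eCP Bx.
have xD := intermediate_jones_commutant sD BD minD eDP Bx.
by rewrite -mulrA xD mulrA xC mulrA.
Qed.

Let V := rotation s A2 (eC * eD).

Lemma angle_rotation_star : star V = V.
Proof.
apply: (rotation_star sB cB qs cE1 E1e qv A2 angle_commutant) => a.
by rewrite starM eC_star eD_star !bc_actM eCP eDP (ce_star cC) (ce_star cD).
Qed.

Lemma angle_rotation_sqr : V * V = (dC * dD)^-1%:C *: V.
Proof.
have act a b := rotation_act sB cB qs cE1 E1e A2 a b angle_commutant.
have angleE : eC * eD = \sum_(l <- s) i1 (EC (ED l)) * e1 * i1 (star (ED l)).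
  rewrite {1}(intermediate_jones_sum sB sD BD tB tD tA minB minD qs dBE qmD dDE minE1 eDP).
  rewrite mulr_sumr; apply: eq_bigr => l _.
  by rewrite !mulrA (bc_mul_incl_jones cB) eCP.
(* Here EC(ED l) eC = eC ED(l) eC, and eD commutes with the adjoint of ED(l): the sum is
   [cocommuting_sum] placed between eC and eD. *)
have angle_sum :
    \sum_(l <- s) i1 (EC (ED l)) * (eC * eD) * i1 (star (ED l)) =
    (dB / (dC * dD))%:C *: (eC * eD).
  transitivity (eC * (\sum_(l <- s) i1 (ED l) * eC * i1 (star (ED l))) * eD).
    rewrite mulr_sumr mulr_suml; apply: eq_bigr => l _.
    rewrite mulrA -(intermediate_jones_cutdown sC minC eCP (ED l)) -!mulrA.
    rewrite (intermediate_jones_comm sD minD eDP)//; apply: (subalg_star sD).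
    exact: (ce_in cD).
  by rewrite cocommuting_sum mulr_algr -scalerAl.
apply: bc_ext; apply: (bc_generators_ind cB qs).
- by rewrite !bc_act0r.
- by move=> X Y hX hY; rewrite !bc_actDr hX hY.
move=> a b; rewrite bc_actM bc_actZl act; set T := eC * eD in act angleE angle_sum *.
(* Module maps are only additive and right linear by definition, so the scalar is taken out as right
   multiplication by an element of A. *)
have -> : bc_act A2 V (dB^-1%:C *: (i1 a * T * i1 b)) =
    dB^-1%:C *: bc_act A2 V (i1 a * T * i1 b).
  have := bc_actMr V (i1 a * T * i1 b) (n := dB^-1%:C%:A).
  rewrite !mulr_algr; apply; exists (dB^-1%:C%:A) => //.
  exact: bc_incl_scalar.
have -> : bc_act A2 V (i1 a * T * i1 b) =
    (dC * dD)^-1%:C *: (i1 a * T * i1 b).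
  rewrite {1}angleE mulr_sumr mulr_suml bc_act_sumr.
  transitivity (dB^-1%:C *: (i1 a *
      (\sum_(l <- s) i1 (EC (ED l)) * T * i1 (star (ED l))) * i1 b)).
    rewrite mulr_sumr mulr_suml scaler_sumr; apply: eq_bigr => l _.
    have -> : i1 a * (i1 (EC (ED l)) * e1 * i1 (star (ED l))) * i1 b =
        i1 (a * EC (ED l)) * e1 * i1 (star (ED l) * b).
      by rewrite !bc_inclM !mulrA.
    by rewrite act !bc_inclM !mulrA.
  rewrite angle_sum -scalerAr -scalerAl scalerA -rmorphM.
  by congr ((real_complex _ _) *: _); field; rewrite ?dB0 ?dC0 ?dD0.
by rewrite !scalerA [_ * dB^-1%:C]mulrC.
Qed.

(** Both expectations fix B, so eC eD e1 = e1, and the sum reduces to the resolution of 1 by the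
    quasi-basis. *)
Lemma angle_rotation_ce (E2 : A2 -> A1) :
  conditional_expectation (range i2) (i2 \o E2) ->
  E2 (bc_jones A2) = dB^-1%:C%:A -> E2 V = dB^-1%:C%:A.
Proof.
move=> cE2 E2e; rewrite (bc_ce_sum cE2).
transitivity (dB^-1%:C *: \sum_(l <- s) i1 l * e1 * i1 (star l)); last first.
  by rewrite (bc_sum1 cB qs).
rewrite scaler_sumr; apply: eq_bigr => l _.
rewrite (bc_ceMr cE1 qv cE2) (bc_ceMl cE1 qv cE2) E2e mulr_algr -scalerAl.
congr (_ *: _); rewrite !mulrA; congr (_ * _); rewrite -!mulrA; congr (_ * _).
apply: bc_ext => a; rewrite !bc_actM eCP eDP bc_jonesP.
have Ba := ce_in cB a.
by rewrite (ce_id cD (BD Ba)) (ce_id cC (BC Ba)).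
Qed.

End CocommutingRotation.

(** * Computation of the entropy *)

Lemma scalar_valueE (R : realType) (A : cstarAlgType R) (c : R[i]) :
  scalar_value (c%:A : A) = c.
Proof. by rewrite /scalar_value; case: xgetP => [b _ /scalar_inj //|/(_ c)/= []]. Qed.

(** Source of the factor 2 in the formula: the entropy is taken at the square of the single nonzero
    value t. *)
Lemma eta_sqr (R : realType) (t : R) : 0 < t -> eta (t * t) = 2 * t * eta t.
Proof.
move=> t0; have tt : 0 < t * t by rewrite mulr_gt0.
by rewrite /eta t0 tt lnM ?posrE//; ring.
Qed.

Theorem theoremB (R : realType) (A : cstarAlgType R) (B C D : set A)
  (simpleA : simple_cstar_subalgebra [set: A])
  (simpleB : simple_cstar_subalgebra B)
  (simpleC : simple_cstar_subalgebra C)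
  (simpleD : simple_cstar_subalgebra D)
  (BC : B `<=` C) (BD : B `<=` D)
  (* E^A_B, E^A_C, E^A_D and [A:B]_0, [A:C]_0, [A:D]_0 *)
  (EB EC ED : A -> A)
  (minB : minimal_expectation B EB)
  (minC : minimal_expectation C EC)
  (minD : minimal_expectation D ED)
  (dB dC dD : R)
  (indexB : has_index EB (dB%:C)%:A)
  (indexC : has_index EC (dC%:C)%:A)
  (indexD : has_index ED (dD%:C)%:A)
  (* the tower B, A, A_1, A_2 with its minimal expectations *)
  (A1 : basic_construction B EB)
  (E1 : A1 -> A)
  (minE1 : minimal_expectation (range (bc_incl A1)) (bc_incl A1 \o E1))
  (A2 : basic_construction (range (bc_incl A1)) (bc_incl A1 \o E1))
  (E2 : A2 -> A1)
  (minE2 : minimal_expectation (range (bc_incl A2)) (bc_incl A2 \o E2))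
  (* the Jones projections e_C, e_D *)
  (eC eD : A1)
  (eCP : bc_act A1 eC = EC)
  (eDP : bc_act A1 eD = ED)
  (* the minimal expectations of A_1 onto C_1 and D_1 *)
  (EC1 ED1 : A1 -> A1)
  (minC1 : minimal_expectation (intermediate_basic_construction eC) EC1)
  (minD1 : minimal_expectation (intermediate_basic_construction eD) ED1)
  (* the quadruple is a co-commuting square *)
  (cocommuting : commuting_square (bc_incl A1 \o E1) EC1 ED1)
  (s : seq A) (qs : quasi_basis EB s) :
  entropy (EB \o E1 \o E2) (fourier A2 dB s (eC * eD)) =
  (2 / Num.sqrt dB * eta (Num.sqrt dB / (dC * dD)))%:C.
Proof.
have sB := cstar_star_subalgebra (proj1 simpleB).
have sC := cstar_star_subalgebra (proj1 simpleC).
have sD := cstar_star_subalgebra (proj1 simpleD).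
have tA := simple_trivial_center simpleA.
have tB := simple_trivial_center simpleB.
have tC := simple_trivial_center simpleC.
have tD := simple_trivial_center simpleD.
have cB := proj1 minB; have cE1 := proj1 minE1; have cE2 := proj1 minE2.
(* The index hypothesis comes with its own quasi-basis; it is transferred to the one defining the
   Fourier transform. *)
have dBE : index_map s 1 = dB%:C%:A.
  have [s' qs' ->] := indexB; rewrite -index_map1.
  by apply: (index_map_change cB) => // n _; rewrite mul1r mulr1.
have [mC qmC dCE] := indexC; have [mD qmD dDE] := indexD.
rewrite -index_map1 in dCE; rewrite -index_map1 in dDE.
have [_ [w [v qv _] _]] := minE1.
have dvE := dual_index sB tB tA minB qs dBE minE1 qv.
have E2e : E2 (bc_jones A2) = dB^-1%:C%:A.
  (* The same result one level higher, for A in [A1], whose index is again [dB] by [dual_index]. *)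
  apply: (ce_jones (bc_incl_star_subalgebra cB qs A1)
    (@bc_incl_trivial_center _ _ _ _ A1 tA) (bc_trivial_center sB cB tB (M := A1))
    minE1 qv dvE minE2).
have dB0 : 0 < dB := index_gt0 sB tB tA minB qs dBE minE1.
have dC0 : 0 < dC.
  exact: (intermediate_index_gt0 sB sC BC tB tC tA minB minC qs dBE qmC (esym dCE) minE1 eCP).
have dD0 : 0 < dD.
  exact: (intermediate_index_gt0 sB sD BD tB tD tA minB minD qs dBE qmD (esym dDE) minE1 eDP).
have cd0 : 0 < dC * dD by rewrite mulr_gt0.
pose V := rotation s A2 (eC * eD).
have sV : star V = V.
  exact: (angle_rotation_star sB sC sD BC BD tB tC tD tA minB minC minD qs dBE
    qmC (esym dCE) qmD (esym dDE) minE1 qv A2 eCP eDP).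
have VV : V * V = (dC * dD)^-1%:C *: V.
  exact: (angle_rotation_sqr sB sC sD BC BD tB tC tD tA minB minC minD qs dBE
    qmC (esym dCE) qmD (esym dDE) minE1 qv A2 eCP eDP (proj1 minC1) (proj1 minD1)).
have E2V : E2 V = dB^-1%:C%:A.
  exact: (angle_rotation_ce BC BD minB minC minD qs minE1 qv eCP eDP cE2).
pose r := Num.sqrt dB.
have r0 : 0 < r by rewrite sqrtr_gt0.
have rr : r * r = dB by rewrite -expr2 sqr_sqrtr ?ltW.
(* The powers of delta = r combine: delta^3 / delta^2 = delta. *)
have FE : fourier A2 dB s (eC * eD) = r%:C *: V.
  rewrite fourierE scalerA -rmorphM; congr ((real_complex _ _) *: _).
  by rewrite -/r -rr; field; rewrite lt0r_neq0.
pose p : A2 := (dC * dD)%:C *: V.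
have sp : star p = p by rewrite starZr sV.
have pp : p * p = p.
  by rewrite /p -scalerAr -scalerAl VV scaleCKV ?lt0r_neq0.
pose t := r / (dC * dD).
have t0 : 0 < t by rewrite divr_gt0.
have FF : star (fourier A2 dB s (eC * eD)) * fourier A2 dB s (eC * eD) =
    (t * t)%:C *: p.
  rewrite FE starZr sV -scalerAr -scalerAl VV !scalerA -!rmorphM.
  by congr ((real_complex _ _) *: _); rewrite /t; field; rewrite !lt0r_neq0.
rewrite /entropy /trace FF fun_calc_projection//; last first.
- by rewrite /eta ltxx.
- by rewrite mulf_neq0 ?lt0r_neq0.
(* The trace of p is dC dD / dB, so the entropy is eta(t^2) dC dD / dB = 2 t eta(t) / (r t). *)
rewrite /p scalerA -rmorphM /= (bc_ceZ cE2) E2V scalerA -rmorphM.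
rewrite (bc_ceZ cE1) (bc_ce1 cE1) (ceZ cB) (ce1 sB cB) scalar_valueE.
congr (real_complex _ _); rewrite eta_sqr// -/r -/t -rr /t.
by field; rewrite !lt0r_neq0.
Qed.
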